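(* Let $q\ge2$, $P:\mathbb{Z}_q^k\to\{0,1\}$ and $\gamma>0$. There is an efficient algorithm that, given $\mathcal{I}\sim\mathcal{F}_{q,P}(n,p)$, certifies that $\mathcal{I}$ is $\gamma$-quasirandom with high probability when $\bar m\ge\frac{q^{O(k)}n^{k/2}\log^5n}{\gamma^2}$.
   Context: An instance $\mathcal{I}$ of CSP$(P)$ over $\mathbb{Z}_q$ on variables $x_1,\dots,x_n\in\mathbb{Z}_q$ is a multiset of constraints $(c,T)$, $T\in[n]^k$, $c\in\mathbb{Z}_q^k$, representing $P(x_T+c)=1$ where $x_T=(x_{T_1},\dots,x_{T_k})$; $m=|\mathcal{I}|$. $\mathcal{F}_{q,P}(n,p)$ includes each of the $q^kn^k$ possible constraints independently with probability $p$; $\bar m=q^kn^kp$. For $x\in\mathbb{Z}_q^n$, the induced distribution on $\mathbb{Z}_q^k$ assigns $\alpha$ probability $\frac1m\#\{(c,T)\in\mathcal{I}:x_T+c=\alpha\}$; $\mathcal{I}$ is $\gamma$-quasirandom if for every $x\in\mathbb{Z}_q^n$ this distribution is within total variation distance $\gamma$ of uniform on $\mathbb{Z}_q^k$. ''With high probability'': probability $1-o(1)$ as $n\to\infty$. An efficient certification algorithm runs in polynomial time, outputs the statement or ''fail'', never outputs the statement when false, and fails with probability $o(1)$. $q^{O(k)}$ denotes $q^{Ck}$ for an absolute constant $C$.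
   Formalization: The formal theorem assumes k ≥ 2; for k = 1 the claim is false when γ < 1 − 1/q, since with about √n·polylog(n) unary constraints, mostly on distinct variables, some x makes x_T + c = 0 for almost all of them. *)

(* Defs.v *)
From mathcomp Require Import all_boot all_order all_algebra.
From mathcomp Require Import all_classical all_reals all_analysis.

Set Implicit Arguments.
Unset Strict Implicit.
Unset Printing Implicit Defensive.

Import Order.TTheory GRing.Theory Num.Theory.

Local Open Scope ring_scope.

(** * Instances of CSP(P) over Z_q *)

(* 'Z_q is Z/qZ only for q >= 2, which is a hypothesis wherever this is used. *)
Definition Zvec (q k : nat) : finType := {ffun 'I_k -> 'Z_q}.

(* A constraint (c, T); the indices in T may repeat, so that there are
   q^k n^k constraints.  The predicate P plays no role in the data. *)
Definition constraint (q k n : nat) : finType :=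
  (Zvec q k * {ffun 'I_k -> 'I_n})%type.

(* A multiset of constraints, listed in some order. *)
Definition instance (q k n : nat) := seq (constraint q k n).

(* x_T + c *)
Definition shifted q k n (x : Zvec q n) (ct : constraint q k n) : Zvec q k :=
  [ffun i => x (ct.2 i) + ct.1 i].

Definition induced (R : realType) q k n (I : instance q k n) (x : Zvec q n)
    (a : Zvec q k) : R :=
  (count (fun ct => shifted x ct == a) I)%:R / (size I)%:R.

Definition uniform_Zvec (R : realType) q k (a : Zvec q k) : R :=
  (q%:R ^+ k)^-1.

Definition tv_dist (R : realType) (T : finType) (D1 D2 : T -> R) : R :=
  2^-1 * \sum_(a : T) `|D1 a - D2 a|.

(* For m = 0 the induced distribution does not exist; the empty instance is
   not counted as quasirandom. *)
Definition quasirandom (R : realType) q k n (gamma : R) (I : instance q k n)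
    : Prop :=
  (0 < size I)%N /\
  forall x : Zvec q n,
    tv_dist (induced R I x) (@uniform_Zvec R q k) <= gamma.

(* Probability of the event E under F_{q,P}(n,p).  The outcome is a set S of
   constraints; E is required to hold however S is presented as a list. *)
Definition prob_random_csp (R : realType) q k n (p : R)
    (E : instance q k n -> Prop) : R :=
  \sum_(S : {set constraint q k n} |
        `[< forall I : instance q k n, perm_eq I (enum S) -> E I >])
     p ^+ #|S| * (1 - p) ^+ #|~: S|.

(** * Random access machines with logarithmic cost

   Programs are structured (while) programs over finitely many arrays of
   natural numbers, indexed by natural numbers.  A step is charged the number
   of bits of the numbers it handles, as in the logarithmic cost criterion of
   Aho, Hopcroft and Ullman, so that polynomial time here is polynomial time on
   Turing machines, although multiplication and division are primitive. *)

Local Open Scope nat_scope.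

Inductive binop := Add | Sub | Mul | Div | Mod | Leq | Eqn.

Definition eval_binop (o : binop) (u v : nat) : nat :=
  match o with
  | Add => u + v
  | Sub => u - v
  | Mul => u * v
  | Div => u %/ v
  | Mod => u %% v
  | Leq => (u <= v : bool)
  | Eqn => (u == v : bool)
  end.

(* [Get a e] is the cell of array [a] at the index given by [e]. *)
Inductive expr :=
| Cst of nat
| Get of nat & expr
| Bin of binop & expr & expr.

(* [Put a e1 e2] stores the value of [e2] in array [a] at index [e1]. *)
Inductive cmd :=
| Skip
| Put of nat & expr & expr
| Seq of cmd & cmd
| If of expr & cmd & cmd
| While of expr & cmd.

(* The first argument is the name of the array, the second the index. *)
Definition store := nat -> nat -> nat.

Definition update (s : store) (a i v : nat) : store :=
  fun b j => if (b == a) && (j == i) then v else s b j.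

Fixpoint eval (s : store) (e : expr) : nat :=
  match e with
  | Cst c => c
  | Get a e1 => s a (eval s e1)
  | Bin o e1 e2 => eval_binop o (eval s e1) (eval s e2)
  end.

(* Length in binary, with bitlen 0 = 1. *)
Definition bitlen (v : nat) : nat := (trunc_log 2 v).+1.

(* The sum of the lengths of the values of all subexpressions. *)
Fixpoint ecost (s : store) (e : expr) : nat :=
  bitlen (eval s e) +
  match e with
  | Cst _ => 0
  | Get _ e1 => ecost s e1
  | Bin _ e1 e2 => ecost s e1 + ecost s e2
  end.

(* [exec A s s' t]: started in [s], the program [A] halts in [s'] at cost [t]. *)
Inductive exec : cmd -> store -> store -> nat -> Prop :=
| exec_skip s : exec Skip s s 1
| exec_put s a e1 e2 :
    exec (Put a e1 e2) s (update s a (eval s e1) (eval s e2))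
      (ecost s e1 + ecost s e2)
| exec_seq A B s s' s'' t t' :
    exec A s s' t -> exec B s' s'' t' -> exec (Seq A B) s s'' (t + t')
| exec_if_true e A B s s' t :
    eval s e != 0 -> exec A s s' t -> exec (If e A B) s s' (ecost s e + t)
| exec_if_false e A B s s' t :
    eval s e == 0 -> exec B s s' t -> exec (If e A B) s s' (ecost s e + t)
| exec_while_false e A s :
    eval s e == 0 -> exec (While e A) s s (ecost s e)
| exec_while_true e A s s' s'' t t' :
    eval s e != 0 -> exec A s s' t -> exec (While e A) s' s'' t' ->
    exec (While e A) s s'' (ecost s e + t + t').

(** * Certification algorithms *)

(* n, m, then T_1 .. T_k, c_1 .. c_k for each constraint. *)
Definition encode q k n (I : instance q k n) : seq nat :=
  n :: size I ::
  flatten [seq codom (fun i => ct.2 i : nat) ++ codom (fun i => ct.1 i : nat)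
          | ct : constraint q k n <- I].

(* The input is in array 0; all other cells are 0. *)
Definition input q k n (I : instance q k n) : store :=
  fun a j => if a == 0 then nth 0 (encode I) j else 0.

(* The answer is in cell 0 of array 1: the value 1 is the statement being
   certified, any other value is "fail". *)
Definition certifies q k n (A : cmd) (I : instance q k n) : Prop :=
  exists s' t, exec A (input I) s' t /\ s' 1 0 = 1.

(* q and k are fixed, so the size of an instance is polynomially related to
   n + m. *)
Definition poly_time (q k : nat) (A : cmd) : Prop :=
  exists a d : nat, forall (n : nat) (I : instance q k n),
    exists s' t, exec A (input I) s' t /\ t <= a * (n + size I).+1 ^ d.

Local Close Scope nat_scope.

(* The algorithm never certifies a false statement, on any instance. *)
Definition sound_for_quasirandom (R : realType) (q k : nat) (gamma : R)
    (A : cmd) : Prop :=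
  forall (n : nat) (I : instance q k n), certifies A I -> quasirandom gamma I.

(* Main.v *)
Require Import Defs.
From mathcomp Require Import all_boot all_order all_algebra.
From mathcomp Require Import all_classical all_reals all_analysis.
From mathcomp Require Import zify ring lra.
(** Write N = qn, Q = N^k, k = 2d + e with e = [odd k], D = N^d, E = N^e, and
   code a constraint (c, T) by the k digits T_i q + c_i < N, so that the
   instance becomes a tensor A on [E] x [D] x [D].  The event x_T + c = alpha
   is a product y(i) u(a) v(b) of indicators, so with B = Q A - j it is enough
   to bound the trilinear form sum B y u v by Q j / g, for some integer j: then
   the induced distribution is close to uniform, and j is close to m.  By
   Cauchy-Schwarz the square of this form is at most E (U^T M V + sum B^2), where
   U = u (x) u, V = v (x) v and M[(a,a'),(b,b')] = sum_i B_i[a,b] B_i[a',b'],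
   without the terms (a,b) = (a',b'), and U^T M V is bounded through the
   Frobenius norm of M_s, where M_0 = M and M_(t+1) = M_t M_t^T.  The program
   computes these integers for every j <= Q, with l = 2^s about log n.

   On a random instance j = floor(pQ) passes: the squared Frobenius norm of
   M_s is the trace of (M M^T)^l, a sum over walks of products of centered
   Bernoulli variables.  With X = sqrt Q and L = pX >= ln^5 n / gamma^2, each
   distinct constraint in a product costs a factor 1/X and all of them together
   gain at most L^(2l).  A walk with v distinct vertices and h distinct indices
   i has at least max(v - 2, 2h) distinct constraints, and the number of
   sequences of r elements of [D], weighted by D^-(number of distinct values), is
   at most r^r.  So the trace exceeds its expected order L^(2l) by a factor at
   most D^2 (2l+2)^(6l+2), and the test allows L^(4l) up to constant^l; Markov's
   inequality concludes since l^3 / L tends to 0 and D^2 is bounded by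
   (constant)^(2l). *)

Set Implicit Arguments.
Unset Strict Implicit.
Unset Printing Implicit Defensive.
Import Order.TTheory GRing.Theory Num.Theory.
Import numFieldNormedType.Exports.

Local Open Scope nat_scope.

(** * Determinism of the machine and lengths of numbers *)

(** [certifies] asks for some accepting run. Once one run has been built, uniqueness of the final
    store makes its answer the answer of every run. *)
Lemma exec_deterministic A s s1 t1 : exec A s s1 t1 ->
  forall s2 t2, exec A s s2 t2 -> s2 = s1.
Proof.
elim=> {A s s1 t1}.
- by move=> s s2 t2 H; inversion H.
- by move=> s a e1 e2 s2 t2 H; inversion H.
- move=> A B s s' s'' t t' _ IHA _ IHB s2 t2 H; inversion H; subst.
  by match goal with HA : exec A _ _ _ |- _ => move: (IHA _ _ HA) => ? end; subst; eauto.
- move=> e A B s s' t ne0 _ IH s2 t2 H; inversion H; subst; first by eauto.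
  by match goal with H0 : is_true (eq_op _ _) |- _ => rewrite H0 in ne0 end.
- move=> e A B s s' t e0 _ IH s2 t2 H; inversion H; subst; last by eauto.
  by match goal with H0 : is_true (~~ _) |- _ => rewrite e0 in H0 end.
- move=> e A s e0 s2 t2 H; inversion H; subst=> //.
  by match goal with H0 : is_true (~~ _) |- _ => rewrite e0 in H0 end.
- move=> e A s s' s'' t t' ne0 _ IH1 _ IH2 s2 t2 H; inversion H; subst.
    by match goal with H0 : is_true (eq_op _ _) |- _ => rewrite H0 in ne0 end.
  by match goal with HA : exec A _ _ _ |- _ => move: (IH1 _ _ HA) => ? end; subst; eauto.
Qed.

Lemma bitlen_leS v : bitlen v <= v.+1.
Proof.
rewrite /bitlen ltnS; case: v => [|v]; first by rewrite trunc_log0.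
have := trunc_logP (isT : 1 < 2) (isT : 0 < v.+1).
by apply: leq_trans; apply: ltnW; apply: ltn_expl.
Qed.

Lemma bitlen_le v b : 0 < b -> v < 2 ^ b -> bitlen v <= b.
Proof.
move=> b0 vb; rewrite /bitlen; case: v vb => [|v] vb; first by rewrite trunc_log0.
rewrite -(ltn_exp2l _ _ (isT : 1 < 2)).
by apply: leq_ltn_trans vb; apply: trunc_logP.
Qed.

(** * Expressions with bounded sums *)

(* [XV i] is the variable bound by the [i]-th enclosing sum; [XS c e] is the
   sum of [e] over the values of its variable below the content of cell [c]
   of array 2. *)
Inductive xe :=
| XC of nat
| XV of nat
| XG of nat & xe
| XB of binop & xe & xe
| XS of nat & xe.

Fixpoint xeval (s : store) (env : seq nat) (e : xe) : nat :=
  match e with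
  | XC c => c
  | XV i => nth 0 env i
  | XG a e1 => s a (xeval s env e1)
  | XB o e1 e2 => eval_binop o (xeval s env e1) (xeval s env e2)
  | XS c e1 => \sum_(i < s 2 c) xeval s (nat_of_ord i :: env) e1
  end.

(* Array 3 holds the registers of the compiled code, and is not readable. *)
Fixpoint wf (n : nat) (e : xe) : bool :=
  match e with
  | XC _ => true
  | XV i => i < n
  | XG a e1 => (a != 3) && wf n e1
  | XB _ e1 e2 => wf n e1 && wf n e2
  | XS _ e1 => wf n.+1 e1
  end.

Definition Reg r := Get 3 (Cst r).
(** The successor makes a strict comparison out of [Leq]. *)
Definition guard ctr c := Bin Leq (Bin Add (Reg ctr) (Cst 1)) (Get 2 (Cst c)).

(* The value of [e] is left in register [r]; the variables are in the
   registers listed in [er]. *)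
Fixpoint compile (er : seq nat) (r : nat) (e : xe) : cmd :=
  match e with
  | XC c => Put 3 (Cst r) (Cst c)
  | XV i => Put 3 (Cst r) (Reg (nth 0 er i))
  | XG a e1 => Seq (compile er r e1) (Put 3 (Cst r) (Get a (Reg r)))
  | XB o e1 e2 =>
    Seq (compile er r e1)
   (Seq (compile er r.+1 e2)
        (Put 3 (Cst r) (Bin o (Reg r) (Reg r.+1))))
  | XS c e1 =>
    Seq (Put 3 (Cst r) (Cst 0))
   (Seq (Put 3 (Cst r.+1) (Cst 0))
        (While (guard r.+1 c)
          (Seq (compile (r.+1 :: er) r.+2 e1)
          (Seq (Put 3 (Cst r) (Bin Add (Reg r) (Reg r.+2)))
               (Put 3 (Cst r.+1) (Bin Add (Reg r.+1) (Cst 1)))))))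
  end.

Lemma xeval_ext s s' env e n : (forall a i, a != 3 -> s a i = s' a i) ->
  wf n e -> xeval s env e = xeval s' env e.
Proof.
move=> ss'; elim: e env n => //= [a e IH|o e1 IH1 e2 IH2|c e IH] env n.
- by case/andP=> a3 we; rewrite (IH _ _ we) ss'.
- by case/andP=> w1 w2; rewrite (IH1 _ _ w1) (IH2 _ _ w2).
- by move=> we; rewrite ss' //; apply: eq_bigr => i _; exact: IH we.
Qed.

(** Frame condition of [compile er r e], whose scratch registers start at [r]. *)
Definition agree r (s s' : store) :=
  forall a i, (a != 3) || (i < r) -> s' a i = s a i.

Lemma agree_trans r1 r2 s s' s'' : r1 <= r2 ->
  agree r1 s s' -> agree r2 s' s'' -> agree r1 s s''.
Proof.
move=> r12 h1 h2 a i ai; rewrite h2 ?h1 //.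
by case/orP: ai => [->//|ir]; rewrite (leq_trans ir r12) orbT.
Qed.

Lemma agree_update r r' s v : r <= r' -> agree r s (update s 3 r' v).
Proof.
move=> rr' a i; rewrite /update; case: eqP => //= _ ir.
by case: eqP => // ii; move: ir; rewrite ii ltnNge rr'.
Qed.

Lemma update_eq s a i v : update s a i v a i = v.
Proof. by rewrite /update !eqxx. Qed.

Lemma update_neq s a i v b j : (b != a) || (j != i) -> update s a i v b j = s b j.
Proof. by rewrite /update; case: eqP => //=; case: eqP. Qed.

(** One parameter controls both the number of rounds of a loop, through array 2, and the bit length
    of every readable cell. A cost polynomial in [G] is then polynomial in the input as soon as [G]
    is. *)
Definition bounded G (s : store) :=
  (forall c, s 2 c <= G) /\ (forall a i, a != 3 -> s a i < 2 ^ G).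

Lemma bounded_agree G s s' r : agree r s s' -> bounded G s -> bounded G s'.
Proof.
by move=> ss' [h1 h2]; split=> [c|a i a3]; rewrite ss' ?a3 // h2.
Qed.

(** The guard is evaluated once more than the body, hence the two different factors. The cost of one
    evaluation is bounded crudely through [bitlen v <= v.+1]. *)
Lemma guard_loop (Inv : nat -> store -> Prop) ctr c n body T :
  (forall i s, Inv i s -> s 3 ctr = i /\ s 2 c = n) ->
  (forall i s, i < n -> Inv i s ->
     exists s' t, [/\ exec body s s' t, Inv i.+1 s' & t <= T]) ->
  forall i s, i <= n -> Inv i s ->
  exists s' t, [/\ exec (While (guard ctr c) body) s s' t, Inv n s'
                 & t <= (n - i) * T + (n - i).+1 * (3 * n + ctr + c + 10)].
Proof.
move=> hI hb i s; move: {2}(n - i) (erefl (n - i)) => m.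
elim: m i s => [|m IH] i s ni lein Is.
  have [h1 h2] := hI _ _ Is.
  have ein : i = n by lia.
  exists s, (ecost s (guard ctr c)); split.
  - by apply: exec_while_false; rewrite /= h1 h2; case: leqP => //; lia.
  - by rewrite -{1}ein.
  - rewrite /= h1 h2.
    have -> : (i + 1 <= n) = false by lia.
    have := bitlen_leS (i + 1); have := bitlen_leS i; have := bitlen_leS n.
    have := bitlen_leS ctr; have := bitlen_leS c; have := bitlen_leS 1.
    have := bitlen_leS (false : nat). rewrite /=. nia.
have [h1 h2] := hI _ _ Is.
have ltin : i < n by lia.
have [s' [t [ex Is' tT]]] := hb _ _ ltin Is.
have [|||s'' [t' [ex' Is'' tT']]] := IH i.+1 s'; [lia|lia|by []|].
exists s'', (ecost s (guard ctr c) + t + t'); split=> //.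
- by apply: exec_while_true ex ex'; rewrite /= h1 h2 addn1 ltin.
- have hc : ecost s (guard ctr c) <= 3 * n + ctr + c + 10.
    rewrite /= h1 h2.
    have -> : (i + 1 <= n) = true by lia.
    have := bitlen_leS (i + 1); have := bitlen_leS i; have := bitlen_leS n.
    have := bitlen_leS ctr; have := bitlen_leS c; have := bitlen_leS 1.
    rewrite /=; lia.
  have e : n - i = (n - i.+1).+1 by lia.
  rewrite e !mulSn; lia.
Qed.

Lemma leq_cexp c c' d d' G : 0 < G -> c <= c' -> d <= d' -> c * G ^ d <= c' * G ^ d'.
Proof.
by move=> G0 cc dd; apply: leq_mul => //; rewrite leq_pexp2l.
Qed.

Lemma exp2_le a b : a <= b -> 2 ^ a <= 2 ^ b.
Proof. by move=> ab; rewrite leq_exp2l. Qed.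

Lemma eval_binop_bits o u v a b : u < 2 ^ a -> v < 2 ^ b ->
  eval_binop o u v < 2 ^ (a + b).+1.
Proof.
move=> ua vb; rewrite expnS expnD.
have a1 : 0 < 2 ^ a by rewrite expn_gt0.
have b1 : 0 < 2 ^ b by rewrite expn_gt0.
case: o => /=.
- nia.
- nia.
- nia.
- have := leq_div u v; nia.
- have := leq_mod u v; nia.
- case: (u <= v) => /=; nia.
- case: (u == v) => /=; nia.
Qed.

(** Induction on [e], with constants that do not depend on the store. An operation adds the lengths
    of its operands and one bit; a sum has at most [G < 2 ^ G] terms and so adds at most [G] bits.
    Lengths therefore stay linear in [G], and costs stay polynomial. *)
Lemma compile_exec e er r : wf (size er) e -> all (fun i => i < r) er ->
  exists c d, forall s G, 0 < G -> bounded G s ->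
    (forall i, i \in er -> s 3 i < 2 ^ G) ->
    exists s' t, [/\ exec (compile er r e) s s' t, agree r s s',
      s' 3 r = xeval s (map (s 3) er) e, s' 3 r < 2 ^ (c * G) & t <= c * G ^ d].
Proof.
elim: e er r => [c|i|a e IH|o e1 IH1 e2 IH2|c e IH] er r /=.
- move=> _ _; exists (c + r + 3), 0 => s G G0 bs hr.
  do 2!eexists; split; first exact: exec_put.
  + exact: agree_update.
  + by rewrite /= update_eq.
  + rewrite /= update_eq; apply: leq_trans (ltn_expl c (isT : 1 < 2)) _.
    apply: exp2_le; clear -G0; nia.
  + rewrite /=; have := bitlen_leS c; have := bitlen_leS r; lia.
- move=> ilt al; exists (nth 0 er i + r + 4), 1 => s G G0 bs hr.
  have ie : nth 0 er i \in er by rewrite mem_nth.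
  do 2!eexists; split; first exact: exec_put.
  + exact: agree_update.
  + by rewrite /= update_eq (nth_map 0).
  + rewrite /= update_eq; apply: leq_trans (hr _ ie) _.
    apply: exp2_le; clear -G0; nia.
  + rewrite /=; have := bitlen_leS (nth 0 er i); have := bitlen_leS r.
    have := bitlen_le G0 (hr _ ie); rewrite expn1; nia.
- case/andP=> a3 we al; have [c [d h]] := IH _ _ we al.
  exists (10 * (c + r + 10)), d.+1 => s G G0 bs hr.
  have [s' [t [ex ag val vb tb]]] := h s G G0 bs hr.
  have [bs1 bs2] := bounded_agree ag bs.
  do 2!eexists; split; first by [apply: exec_seq ex _; exact: exec_put].
  + by apply: agree_trans ag _; first exact: leqnn; apply: agree_update.
  + by rewrite /= update_eq val ag // a3.
  + rewrite /= update_eq; apply: leq_trans (bs2 a _ a3) _; apply: exp2_le; clear -G0; nia.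
  + rewrite /=.
    have h1 := bitlen_leS r.
    have h2 := bitlen_le G0 (bs2 a (s' 3 r) a3).
    have h3 : bitlen (s' 3 r) <= (c + 1) * G.
      by apply: bitlen_le; [clear -G0; nia | apply: leq_trans vb _; apply: exp2_le; nia].
    have h4 : c * G ^ d <= c * G ^ d.+1 by apply: leq_cexp.
    have h5 : G <= G ^ d.+1 by rewrite -[leqLHS]expn1 leq_pexp2l.
    have : (c + 1) * G <= (c+1) * G ^ d.+1 by rewrite leq_mul2l h5 orbT.
    have : r.+1 <= r.+1 * G ^ d.+1 by rewrite leq_pmulr // (leq_trans G0).
    move: h2 h3 h4 h5 tb; clear -h1.
    move: (G ^ d.+1) => X; nia.
- case/andP=> w1 w2 al; have [c1 [d1 h1]] := IH1 _ _ w1 al.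
  have al' : all (fun i => i < r.+1) er.
    by apply: sub_all al => i /= /leqW.
  have [c2 [d2 h2]] := IH2 _ _ w2 al'.
  exists (10 * (c1 + c2 + r + 10)), (d1 + d2).+1 => s G G0 bs hr.
  have [s' [t [ex ag val vb tb]]] := h1 s G G0 bs hr.
  have rg i : i \in er -> s' 3 i = s 3 i.
    by move=> ie; rewrite ag // (allP al _ ie) orbT.
  have hr' i : i \in er -> s' 3 i < 2 ^ G by move=> ie; rewrite rg // hr.
  have [s'' [t' [ex' ag' val' vb' tb']]] := h2 s' G G0 (bounded_agree ag bs) hr'.
  have val1 : s'' 3 r = s' 3 r by rewrite ag' // ltnSn orbT.
  have val2 : s'' 3 r.+1 = xeval s [seq s 3 i | i <- er] e2.
    rewrite val'; have -> : [seq s' 3 i | i <- er] = [seq s 3 i | i <- er].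
      by apply/eq_in_map.
    by apply: xeval_ext w2 => a i a3; rewrite ag // a3.
  have eb := eval_binop_bits o vb vb'.
  do 2!eexists; split.
    by apply: exec_seq ex _; apply: exec_seq ex' _; exact: exec_put.
  + apply: agree_trans ag _; first exact: leqnn.
    apply: agree_trans (leqnn _) _ (agree_update _ _ (leqnn _)).
    by move=> a i ai; apply: ag'; case/orP: ai => [->//|/leqW->]; rewrite orbT.
  + by rewrite /= update_eq val1 val val2.
  + rewrite /= update_eq val1; apply: leq_trans eb _; apply: exp2_le; clear -G0; nia.
  + rewrite /= val1.
    have h3 := bitlen_leS r.
    have h4 : bitlen (s' 3 r) <= (c1 + c2 + 1) * G.
      by apply: bitlen_le; [clear -G0; nia | apply: leq_trans vb _; apply: exp2_le; nia].
    have h5 : bitlen (s'' 3 r.+1) <= (c1 + c2 + 1) * G.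
      by apply: bitlen_le; [clear -G0; nia | apply: leq_trans vb' _; apply: exp2_le; nia].
    have h6 : bitlen (eval_binop o (s' 3 r) (s'' 3 r.+1)) <= (c1 + c2 + 1) * G.
      apply: bitlen_le; first nia.
      by apply: leq_trans eb _; apply: exp2_le; clear -G0; nia.
    have h7 := bitlen_leS r.+1.
    set X := G ^ (d1 + d2).+1.
    have k1 : c1 * G ^ d1 <= c1 * X by apply: leq_cexp => //; lia.
    have k2 : c2 * G ^ d2 <= c2 * X by apply: leq_cexp => //; lia.
    have k3 : G <= X by rewrite -[leqLHS]expn1 leq_pexp2l.
    have k4 : (c1 + c2 + 1) * G <= (c1 + c2 + 1) * X by rewrite leq_mul2l k3 orbT.
    move: h4 h5 h6 k1 k2 k3 k4 tb tb'; clear -G0 h3 h7; nia.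
- move=> we al.
  have al' : all (fun i => i < r.+2) (r.+1 :: er).
    by rewrite /= ltnSn /=; apply: sub_all al => i /= /leqW/leqW.
  have [c1 [d1 h1]] := IH (r.+1 :: er) r.+2 we al'.
  exists (30 * (c1 + r + c + 100)), (d1 + 2) => s G G0 bs hr.
  set s0 := update (update s 3 r 0) 3 r.+1 0.
  set f := fun i => xeval s (i :: [seq s 3 i | i <- er]) e.
  have nG : s 2 c <= G by case: bs.
  (* A partial sum has at most [G] terms, each at most 2^(c1 G); the + 1 makes the bound strict. *)
  pose Inv i s1 := [/\ agree r s s1, s1 3 r = \sum_(j < i) f j, s1 3 r < G * 2 ^ (c1 * G) + 1 & s1 3 r.+1 = i].
  have inv0 : Inv 0 s0.
    split.
    - apply: agree_trans (agree_update _ _ (leqnn _)) (agree_update _ _ _) => //.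
    - by rewrite big_ord0 /s0 update_neq ?update_eq //= neq_ltn ltnSn.
    - by rewrite /s0 update_neq ?update_eq //= ?addn1 // neq_ltn ltnSn.
    - by rewrite /s0 update_eq.
  have ctrP i s1 : Inv i s1 -> s1 3 r.+1 = i /\ s1 2 c = s 2 c.
    by case=> ag _ _ ->; split=> //; rewrite ag.
  have mB m : m * 2 ^ (c1 * G) <= m * 2 ^ ((c1 + 1) * G).
    by rewrite leq_mul2l; apply/orP; right; apply: exp2_le; clear -G0; nia.
  have GB : G * 2 ^ (c1 * G) < 2 ^ ((c1 + 1) * G).
    by rewrite mulnDl mul1n expnD mulnC ltn_pmul2l ?expn_gt0 // ltn_expl.
  have sB : G * 2 ^ (c1 * G) + 1 <= 2 ^ ((c1 + 1) * G) by rewrite addn1.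
  pose T := (c1 + 5) * G ^ d1 + (10 * (c1 + r + 5)) * G.
  have step i s1 : i < s 2 c -> Inv i s1 -> exists s' t,
     [/\ exec (Seq (compile (r.+1 :: er) r.+2 e)
          (Seq (Put 3 (Cst r) (Bin Add (Reg r) (Reg r.+2)))
               (Put 3 (Cst r.+1) (Bin Add (Reg r.+1) (Cst 1))))) s1 s' t,
         Inv i.+1 s' & t <= T].
    move=> ic [ag vr vrb vi].
    have rg j : j \in er -> s1 3 j = s 3 j.
      by move=> ie; rewrite ag // (allP al _ ie) orbT.
    have iG : i < 2 ^ G by apply: leq_trans (ltn_expl G (isT : 1 < 2)); lia.
    have hr' j : j \in r.+1 :: er -> s1 3 j < 2 ^ G.
      by rewrite inE => /orP[/eqP->|ie]; rewrite ?vi // rg // hr.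
    have [s2 [t [ex ag2 val vb tb]]] := h1 s1 G G0 (bounded_agree ag bs) hr'.
    have valE : s2 3 r.+2 = f i.
      rewrite val /f /= vi; have -> : [seq s1 3 i | i <- er] = [seq s 3 i | i <- er].
        by apply/eq_in_map.
      by apply: xeval_ext we => a j a3; rewrite ag // a3.
    have vr2 : s2 3 r = s1 3 r by rewrite ag2 // ltnW ?orbT // ltnSn.
    have vi2 : s2 3 r.+1 = i by rewrite ag2 ?ltnSn ?orbT.
    do 2!eexists; split.
      by apply: exec_seq ex _; apply: exec_seq; exact: exec_put.
    - have e3 : r == r.+1 = false by rewrite eqn_leq ltnn andbF.
      split.
      + apply: agree_trans ag _; first exact: leqnn.
        apply: agree_trans (leqnn _) _ (agree_update _ _ _); last by [].
        apply: agree_trans (leqnn _) _ (agree_update _ _ _); last by [].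
        by move=> a j aj; apply: ag2; case/orP: aj => [->//|/leqW/leqW->]; rewrite orbT.
      + by rewrite update_neq ?e3 // update_eq /= vr2 valE vr big_ord_recr.
      + rewrite update_neq ?e3 // update_eq /= vr2 valE vr.
        have -> : \sum_(j < i) f j + f i = \sum_(j < i.+1) f j by rewrite big_ord_recr.
        rewrite addn1 ltnS.
        apply: (@leq_trans (i.+1 * 2 ^ (c1 * G))); last first.
          by rewrite leq_mul2r; apply/orP; right; apply: leq_trans nG.
        rewrite -[i.+1 in leqRHS]card_ord -sum_nat_const; apply: leq_sum => j _.
        have jc : j < s 2 c by apply: leq_trans ic.
        have jG : j < 2 ^ G by apply: leq_trans (ltn_expl G (isT : 1 < 2)); lia.
        (* The induction hypothesis bounds only values left by a run of the compiled code. The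
           summand at an earlier [j] is bounded by running that code from a store whose counter is
           set to [j]. *)
        pose sj := update s1 3 r.+1 j.
        have agj : agree r s sj.
          by apply: agree_trans ag (agree_update _ _ _).
        have hrj k : k \in r.+1 :: er -> sj 3 k < 2 ^ G.
          rewrite inE => /orP[/eqP->|ie]; first by rewrite /sj update_eq.
          rewrite agj ?hr //; by rewrite (allP al _ ie) orbT.
        have [s3 [t3 [_ _ val3 vb3 _]]] := h1 sj G G0 (bounded_agree agj bs) hrj.
        suff <- : s3 3 r.+2 = f j by exact: ltnW.
        rewrite val3 /f /=; have -> : sj 3 r.+1 = j by rewrite /sj update_eq.
        have -> : [seq sj 3 i | i <- er] = [seq s 3 i | i <- er].
          by apply/eq_in_map => k ke; rewrite agj // (allP al _ ke) orbT.
        by apply: xeval_ext we => a k a3; rewrite agj // a3.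
      + by rewrite update_eq /= update_neq ?vi2 ?addn1 // eq_sym e3.
    - have e3 : r.+1 == r = false by rewrite eqn_leq ltnn.
      rewrite /= update_neq ?e3 // vi2 vr2.
      have sumb : s1 3 r + s2 3 r.+2 < 2 ^ ((c1 + 1) * G + c1 * G).+1.
        have := @eval_binop_bits Add _ _ _ _ (leq_trans vrb sB) vb; exact.
      have k1 : bitlen (s1 3 r + s2 3 r.+2) <= ((c1 + 1) * G + c1 * G).+1.
        exact: bitlen_le.
      have k2 : bitlen (s1 3 r) <= (c1 + 1) * G.
        by apply: bitlen_le; [clear -G0; nia | apply: leq_trans vrb sB].
      have k3 : bitlen (s2 3 r.+2) <= (c1 + 1) * G.
        by apply: bitlen_le; [clear -G0; nia | apply: leq_trans vb _; apply: exp2_le; nia].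
      have k4 := bitlen_leS r; have k5 := bitlen_leS r.+1; have k6 := bitlen_leS r.+2.
      have k7 := bitlen_leS i; have k8 := bitlen_leS (i + 1); have k9 := bitlen_leS 1.
      rewrite /T; move: k1 k2 k3 k4 k5 k6 k7 k8 k9 tb; clear -G0 nG ic; nia.
  have [s' [t [ex [ag vr vrb vi] tb]]] :=
    guard_loop ctrP step (leq0n _) inv0.
  do 2!eexists; split.
    by apply: exec_seq; [exact: exec_put | apply: exec_seq; [exact: exec_put | exact: ex]].
  + exact: ag.
  + by rewrite vr.
  + apply: leq_trans vrb _; apply: leq_trans sB _; apply: exp2_le; clear -G0; nia.
  + rewrite /=.
    have k4 := bitlen_leS r; have k5 := bitlen_leS r.+1; have k6 := bitlen_leS 0.
    move: tb; rewrite subn0 => tb.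
    apply: leq_trans (_ : r + r + 10 + t <= _); first by lia.
    set X := G ^ (d1 + 2).
    have j1 : G * G ^ d1 <= X by rewrite -expnS leq_pexp2l //; lia.
    have j2 : G * G <= X.
      by rewrite -[X in X * _]expn1 -[X in _ * X]expn1 -expnD leq_pexp2l //; lia.
    have j3 : G <= X by rewrite -[leqLHS]expn1 leq_pexp2l //; lia.
    have j4 : s 2 c * T <= G * T by rewrite leq_mul2r nG orbT.
    have j5 : G * T <= (c1 + 5) * X + 10 * (c1 + r + 5) * X.
      rewrite /T mulnDr; apply: leq_add.
        by rewrite mulnCA leq_mul2l j1 orbT.
      by rewrite mulnCA leq_mul2l j2 orbT.
    have j6 : (s 2 c).+1 * (3 * s 2 c + r.+1 + c + 10) <= (G + 1) * (3 * G + r.+1 + c + 10).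
      by apply: leq_mul; lia.
    have j7 : (G + 1) * (3 * G + r.+1 + c + 10) <= 3 * (G * G) + (r + c + 14) * G + (r + c + 11) by nia.
    have j8 : (r + c + 14) * G <= (r + c + 14) * X by rewrite leq_mul2l j3 orbT.
    have j9 : (r + c + 11) <= (r + c + 11) * X by rewrite leq_pmulr // (leq_trans G0).
    move: tb j4 j5 j6 j7 j8 j9 j2; clear; lia.
Qed.

(** * Programs made of cell assignments and table fillings *)

Definition Fill a c e :=
  Seq (Put 3 (Cst 0) (Cst 0))
      (While (guard 0 c)
        (Seq (compile [:: 0] 1 e)
        (Seq (Put a (Reg 0) (Reg 1))
             (Put 3 (Cst 0) (Bin Add (Reg 0) (Cst 1)))))).

Definition Set_cell a i e := Seq (compile [::] 0 e) (Put a (Cst i) (Reg 0)).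

Definition filled (sg : store) a n (f : nat -> nat) : store :=
  fun b i => if (b == a) && (i < n) then f i else sg b i.

Definition eqm (s sg : store) := forall a i, a != 3 -> s a i = sg a i.

Lemma eqm_bounded G s sg : eqm s sg -> bounded G sg -> bounded G s.
Proof. by move=> h [h1 h2]; split=> [c|a i a3]; rewrite h // h2. Qed.

(** Entry [z] is computed when the entries below [z] are already in place, so [e] may read them: one
    loop performs a course-of-values recursion. Array 2 is excluded because it holds the bound of
    the loop. *)
Lemma Fill_exec a c e : wf 1 e -> a != 3 -> a != 2 ->
  exists C d, forall sg f s G, 0 < G -> bounded G sg -> eqm s sg ->
    (forall z, z < sg 2 c -> f z < 2 ^ G) ->
    (forall z, z < sg 2 c -> xeval (filled sg a z f) [:: z] e = f z) ->
    exists s' t, [/\ exec (Fill a c e) s s' t, eqm s' (filled sg a (sg 2 c) f)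
                   & t <= C * G ^ d].
Proof.
move=> we a3 a2; have [C1 [d1 h1]] := @compile_exec e [:: 0] 1 we isT.
exists (30 * (C1 + c + 100)), (d1 + 2) => sg f s G G0 bs ssg fG fE.
pose s0 := update s 3 0 0; pose n := sg 2 c.
have nG : n <= G by exact: bs.1.
pose Inv i s1 := eqm s1 (filled sg a i f) /\ s1 3 0 = i.
have inv0 : Inv 0 s0.
  split; last by rewrite /s0 update_eq.
  move=> b i b3; rewrite /s0 update_neq ?b3 // /filled ltn0 andbF; exact: ssg.
have ctrP i s1 : Inv i s1 -> s1 3 0 = i /\ s1 2 c = n.
  by case=> h ->; split=> //; rewrite h // /filled eq_sym (negPf a2).
pose T := (C1 + 5) * G ^ d1 + 10 * (C1 + 15) * G.
have step i s1 : i < n -> Inv i s1 -> exists s' t,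
  [/\ exec (Seq (compile [:: 0] 1 e) (Seq (Put a (Reg 0) (Reg 1))
             (Put 3 (Cst 0) (Bin Add (Reg 0) (Cst 1))))) s1 s' t,
      Inv i.+1 s' & t <= T].
  move=> iN [e1 ei].
  have bs1 : bounded G s1.
    apply: eqm_bounded e1 _; case: bs => b1 b2; split=> [k|b j b3].
      by rewrite /filled eq_sym (negPf a2) /=; exact: b1.
    rewrite /filled; case: ifP => [/andP[_ ji]|_]; last exact: b2.
    by apply: fG; apply: ltn_trans ji iN.
  have iG : i < 2 ^ G by apply: leq_trans (ltn_expl G (isT : 1 < 2)); lia.
  have hr k : k \in [:: 0] -> s1 3 k < 2 ^ G by rewrite inE => /eqP->; rewrite ei.
  have [s2 [t [ex ag val vb tb]]] := h1 s1 G G0 bs1 hr.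
  have valE : s2 3 1 = f i.
    by rewrite val /= ei -fE //; apply: xeval_ext we.
  have s20 : s2 3 0 = i by rewrite ag.
  do 2!eexists; split.
    by apply: exec_seq ex _; apply: exec_seq; exact: exec_put.
  - rewrite /= s20 valE; split; last first.
      by rewrite update_eq update_neq ?addn1 ?s20 // eq_sym (negPf a3).
    move=> b j b3; rewrite update_neq ?b3 // /update /filled ltnS leq_eqVlt.
    case: eqP => [-> /=|/eqP ba /=]; last by rewrite ag ?b3 // e1 // /filled (negPf ba).
    case: eqP => [->//|ji /=]; by rewrite ag ?a3 // e1 // /filled eqxx.
  - rewrite /= update_neq ?(eq_sym 3) ?a3 // s20.
    have k1 := bitlen_leS i; have k2 := bitlen_leS (i + 1).
    have k3 := bitlen_leS 0; have k4 := bitlen_leS 1.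
    have k5 : bitlen (s2 3 1) <= (C1 + 1) * G.
      by apply: bitlen_le; [clear -G0; nia | apply: leq_trans vb _; apply: exp2_le; nia].
    rewrite /T; move: k1 k2 k3 k4 k5 tb; clear -G0 nG iN; nia.
have [s' [t [ex [ag _] tb]]] := guard_loop ctrP step (leq0n _) inv0.
do 2!eexists; split; [|exact: ag|].
  by apply: exec_seq; [exact: exec_put | exact: ex].
rewrite /=.
have k4 := bitlen_leS 0.
move: tb; rewrite subn0 => tb.
apply: leq_trans (_ : 10 + t <= _); first by lia.
set X := G ^ (d1 + 2).
have j1 : G * G ^ d1 <= X by rewrite -expnS leq_pexp2l //; lia.
have j2 : G * G <= X.
  by rewrite -[X in X * _]expn1 -[X in _ * X]expn1 -expnD leq_pexp2l //; lia.
have j3 : G <= X by rewrite -[leqLHS]expn1 leq_pexp2l //; lia.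
have j4 : n * T <= G * T by rewrite leq_mul2r nG orbT.
have j5 : G * T <= (C1 + 5) * X + 10 * (C1 + 15) * X.
  rewrite /T mulnDr; apply: leq_add.
    by rewrite mulnCA leq_mul2l j1 orbT.
  by rewrite mulnCA leq_mul2l j2 orbT.
have j6 : n.+1 * (3 * n + 0 + c + 10) <= (G + 1) * (3 * G + 0 + c + 10).
  by apply: leq_mul; lia.
have j7 : (G + 1) * (3 * G + 0 + c + 10) <= 3 * (G * G) + (c + 14) * G + (c + 11) by nia.
have j8 : (c + 14) * G <= (c + 14) * X by rewrite leq_mul2l j3 orbT.
have j9 : (c + 11) <= (c + 11) * X by rewrite leq_pmulr // (leq_trans G0).
move: tb j4 j5 j6 j7 j8 j9 j2; clear; lia.
Qed.

Lemma Set_exec a i e : wf 0 e -> a != 3 ->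
  exists C d, forall sg s G, 0 < G -> bounded G sg -> eqm s sg ->
    exists s' t, [/\ exec (Set_cell a i e) s s' t,
      eqm s' (update sg a i (xeval sg [::] e)) & t <= C * G ^ d].
Proof.
move=> we a3; have [C1 [d1 h1]] := @compile_exec e [::] 0 we isT.
exists (10 * (C1 + i + 10)), d1.+1 => sg s G G0 bs ssg.
have [//|s' [t [ex ag val vb tb]]] := h1 s G G0 (eqm_bounded ssg bs).
do 2!eexists; split; first by [apply: exec_seq ex _; exact: exec_put].
- move=> b j b3 /=; rewrite val /= (xeval_ext _ ssg we) /update.
  by case: ifP => // _; rewrite ag ?b3 // ssg.
- rewrite /=.
  have h2 := bitlen_leS i; have h3 := bitlen_leS 0.
  have h4 : bitlen (s' 3 0) <= (C1 + 1) * G.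
    by apply: bitlen_le; [clear -G0; nia | apply: leq_trans vb _; apply: exp2_le; nia].
  have k1 : C1 * G ^ d1 <= C1 * G ^ d1.+1 by apply: leq_cexp.
  have k2 : G <= G ^ d1.+1 by rewrite -[leqLHS]expn1 leq_pexp2l.
  have k3 : (C1 + 1) * G <= (C1 + 1) * G ^ d1.+1 by rewrite leq_mul2l k2 orbT.
  have : i.+1 <= i.+1 * G ^ d1.+1 by rewrite leq_pmulr // (leq_trans G0).
  move: h4 tb k1 k2 k3 G0; clear -h2 h3; move: (G ^ d1.+1) => X; nia.
Qed.

Inductive instr := ISet of nat & nat & xe | IFill of nat & nat & xe.

Definition icmd ins :=
  match ins with ISet a i e => Set_cell a i e | IFill a c e => Fill a c e end.

Definition wfi ins :=
  match ins with
  | ISet a _ e => (a != 3) && wf 0 e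
  | IFill a _ e => [&& a != 3, a != 2 & wf 1 e]
  end.

Definition istep sg ins sg' :=
  match ins with
  | ISet a i e => sg' = update sg a i (xeval sg [::] e)
  | IFill a c e => exists2 f,
      (forall z, z < sg 2 c -> xeval (filled sg a z f) [:: z] e = f z)
      & sg' = filled sg a (sg 2 c) f
  end.

(** Boundedness is imposed on each intermediate store, because the cost of an instruction is
    controlled by the contents of the stores around it. *)
Fixpoint runs G sg l sg' :=
  if l is ins :: l' then
    exists sg1, [/\ istep sg ins sg1, bounded G sg1 & runs G sg1 l' sg']
  else sg' = sg.

Definition program l := foldr Seq Skip (map icmd l).

Lemma program_exec l : all wfi l ->
  exists C d, forall sg sg' s G, 0 < G -> bounded G sg -> eqm s sg ->
    runs G sg l sg' ->
    exists s' t, [/\ exec (program l) s s' t, eqm s' sg' & t <= C * G ^ d].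
Proof.
elim: l => [|ins l IH] /=.
  move=> _; exists 1, 0 => sg sg' s G G0 _ ssg ->; exists s, 1; split=> //.
  exact: exec_skip.
case/andP=> wi /IH[C2 [d2 h2]].
have [C1 [d1 h1]] : exists C d, forall sg sg' s G, 0 < G -> bounded G sg ->
    bounded G sg' -> eqm s sg -> istep sg ins sg' ->
    exists s' t, [/\ exec (icmd ins) s s' t, eqm s' sg' & t <= C * G ^ d].
  case: {IH h2} ins wi => [a i e /andP[a3 we]|a c e /and3P[a3 a2 we]] /=.
    have [C [d h]] := Set_exec i we a3; exists C, d => sg sg' s G G0 b b' ssg ->.
    exact: h.
  have [C [d h]] := Fill_exec c we a3 a2; exists C, d => sg sg' s G G0 b b' ssg.
  case=> f fE sg'E; rewrite sg'E; apply: h => // z zc.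
  by have := b'.2 a z a3; rewrite sg'E /filled eqxx zc.
exists (C1 + C2), (d1 + d2) => sg sg' s G G0 b ssg [sg1 [st b1 rn]].
have [s1 [t1 [ex1 e1 tb1]]] := h1 _ _ _ _ G0 b b1 ssg st.
have [s2 [t2 [ex2 e2 tb2]]] := h2 _ _ _ _ G0 b1 e1 rn.
exists s2, (t1 + t2); split=> //; first exact: exec_seq ex1 ex2.
rewrite mulnDl; apply: leq_add.
  by apply: leq_trans tb1 _; apply: leq_cexp => //; exact: leq_addr.
by apply: leq_trans tb2 _; apply: leq_cexp => //; exact: leq_addl.
Qed.

Lemma bounded_update G sg a i v : bounded G sg -> v < 2 ^ G ->
  (a == 2 -> v <= G) -> bounded G (update sg a i v).
Proof.
move=> [b1 b2] vG va; split=> [c|b j b3]; rewrite /update.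
  by case: ifP => [/andP[/eqP a2 _]|_]; [apply: va; rewrite -a2 | exact: b1].
by case: ifP => // _; exact: b2.
Qed.

Lemma bounded_filled G sg a n f : bounded G sg -> a != 2 ->
  (forall z, z < n -> f z < 2 ^ G) -> bounded G (filled sg a n f).
Proof.
move=> [b1 b2] a2 fG; split=> [c|b j b3]; rewrite /filled.
  by rewrite eq_sym (negPf a2); exact: b1.
by case: ifP => [/andP[_ /fG]|_] //; exact: b2.
Qed.

(** * The certification program *)

(* Entry at row (a, a'), column (b, b') of the positive (sg = 0) or negative
   (sg = 1) part of the matrix M_t, where M_(t+1) is M_t times its transpose and
   M_0 is the scaled sum over i of B_i[a,b] B_i[a',b'] without the terms with
   (a,b) = (a',b'), for the tensor B = Q A - j. *)
Fixpoint walkmx (A : nat -> nat) (g E D Q j t sg a a' b b' : nat) : nat :=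
  match t with
  | 0 => \sum_(i < E) 2 * g * g * Q * (1 - (a == a') * (b == b')) *
      ((1 - sg) * (Q * Q * (A (b + D * (a + D * i)) * A (b' + D * (a' + D * i))) + j * j)
       + sg * (j * Q * (A (b + D * (a + D * i)) + A (b' + D * (a' + D * i)))))
  | t'.+1 => \sum_(u < 2) \sum_(e < D) \sum_(e' < D)
      walkmx A g E D Q j t' u a a' e e' *
      walkmx A g E D Q j t' ((sg + u) %% 2) b b' e e'
  end.

(** The machine knows natural numbers only, so a matrix is kept as a difference P - M. The
    inequality sum (P - M)^2 <= (Q j)^(4 2^s) is tested with the cross terms moved to the right. *)
Definition frobenius_test (A : nat -> nat) g E D Q j s : bool :=
  let P := walkmx A g E D Q j s 0 in
  let M := walkmx A g E D Q j s 1 in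
  \sum_(a < D) \sum_(a' < D) \sum_(b < D) \sum_(b' < D)
     (P a a' b b' * P a a' b b' + M a a' b b' * M a a' b b')
  <= (Q * j) ^ (4 * 2 ^ s) +
  \sum_(a < D) \sum_(a' < D) \sum_(b < D) \sum_(b' < D)
     2 * (P a a' b b' * M a a' b b').

(** Likewise 2 g^2 E sum (Q A_z - j)^2 <= (Q j)^2, written without subtraction. *)
Definition diagonal_test (A : nat -> nat) g E Q j : bool :=
  2 * g * g * E * (\sum_(z < Q) (Q * Q * (A z * A z) + j * j))
  <= Q * j * (Q * j) + 2 * g * g * E * (\sum_(z < Q) 2 * (j * Q * A z)).

Definition accepts (A : nat -> nat) g E D Q s : bool :=
  0 < \sum_(j < Q.+1) (1 <= j) * frobenius_test A g E D Q j s *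
                      diagonal_test A g E Q j.

(** Mixed-radix index of a table entry, where [top] stands for t (Q + 1) + j. As t is most
    significant, level t + 1 comes after level t and one pass fills the table. *)
Definition pack D top sg a a' b b' := ((((top * 2 + sg) * D + a) * D + a') * D + b) * D + b'.

Definition walkmx_cell A g E D Q z :=
  let top := z %/ D %/ D %/ D %/ D %/ 2 in
  walkmx A g E D Q (top %% Q.+1) (top %/ Q.+1) (z %/ D %/ D %/ D %/ D %% 2)
   (z %/ D %/ D %/ D %% D) (z %/ D %/ D %% D) (z %/ D %% D) (z %% D).

Definition power_cell Q z := (Q * (z %% Q.+1)) ^ (4 * 2 ^ (z %/ Q.+1)).

Lemma divnMDr m p d : p < d -> (m * d + p) %/ d = m.
Proof. by move=> pd; rewrite divnMDl ?divn_small ?addn0 // (leq_ltn_trans _ pd). Qed.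

Lemma modnMDr m p d : p < d -> (m * d + p) %% d = p.
Proof. by move=> pd; rewrite modnMDl modn_small. Qed.

Lemma walkmx_cell_pack A g E D Q top sg a a' b b' :
  sg < 2 -> a < D -> a' < D -> b < D -> b' < D ->
  walkmx_cell A g E D Q (pack D top sg a a' b b') =
  walkmx A g E D Q (top %% Q.+1) (top %/ Q.+1) sg a a' b b'.
Proof.
by move=> s2 aD aD' bD bD'; rewrite /walkmx_cell /pack !(divnMDr, modnMDr).
Qed.

Lemma pack_lt D top sg a a' b b' z :
  sg < 2 -> a < D -> a' < D -> b < D -> b' < D ->
  top < z %/ D %/ D %/ D %/ D %/ 2 -> pack D top sg a a' b b' < z.
Proof.
move=> s2 aD aD' bD bD'; apply: contraTT; rewrite -!leqNgt => zp.
have -> : top = pack D top sg a a' b b' %/ D %/ D %/ D %/ D %/ 2.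
  by rewrite /pack !divnMDr.
by do !apply: leq_div2r.
Qed.

Definition xpow e i := iter i (XB Mul e) (XC 1).
Definition inp i := XG 0 (XC i).
Definition par i := XG 2 (XC i).

Section Program.
Variables q k g : nat.

Definition NE := XB Mul (XC q) (inp 0).

Definition inputE j := XG 0 (XB Add (XC (2 + j)) (XB Mul (XC (2 * k)) (XV 0))).
Definition digitE i := XB Add (XB Mul (inputE i) (XC q)) (inputE (k + i)).
Definition codeE := foldr (fun i acc => XB Add (digitE i) (XB Mul NE acc)) (XC 0) (iota 0 k).

(** The recurrence log z = 1 + log (z / 2) for z >= 2, read from array 4 while it is being filled;
    multiplying by a truth value replaces a conditional. *)
Definition logE := XB Mul (XB Leq (XC 2) (XV 0)) (XB Add (XC 1) (XG 4 (XB Div (XV 0) (XC 2)))).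

Definition zdivE v i := iter i (fun e => XB Div e (par 3)) (XV v).
Definition coordE v i := XB Mod (zdivE v i) (par 3).
Definition sgE v := XB Mod (zdivE v 4) (XC 2).
Definition topE v := XB Div (zdivE v 4) (XC 2).
Definition packE top sg a a' b b' :=
  let step x y := XB Add (XB Mul x (par 3)) y in
  step (step (step (step (XB Add (XB Mul top (XC 2)) sg) a) a') b) b'.

Definition isZE v := XB Eqn (XB Div (topE v) (par 5)) (XC 0).

Definition entryE a b i := XG 5 (XB Add b (XB Mul (par 3) (XB Add a (XB Mul (par 3) i)))).

Definition baseE :=
  let j := XB Mod (topE 1) (par 5) in
  let A1 := entryE (coordE 1 3) (coordE 1 1) (XV 0) in
  let A2 := entryE (coordE 1 2) (coordE 1 0) (XV 0) in
  XB Mul (XB Mul (XB Mul (XC (2 * g * g)) (par 4))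
     (XB Defs.Sub (XC 1) (XB Mul (XB Eqn (coordE 1 3) (coordE 1 2)) (XB Eqn (coordE 1 1) (coordE 1 0)))))
   (XB Add
     (XB Mul (XB Defs.Sub (XC 1) (sgE 1))
        (XB Add (XB Mul (XB Mul (par 4) (par 4)) (XB Mul A1 A2)) (XB Mul j j)))
     (XB Mul (sgE 1) (XB Mul (XB Mul j (par 4)) (XB Add A1 A2)))).

(** Variables 0, 1, 2 are e', e, u of the triple sum and variable 3 is the index being filled.
    Subtracting Q + 1 from [top] lowers t by one and keeps j. *)
Definition recE :=
  let top := XB Defs.Sub (topE 3) (par 5) in
  XB Mul (XG 6 (packE top (XV 2) (coordE 3 3) (coordE 3 2) (XV 1) (XV 0)))
         (XG 6 (packE top (XB Mod (XB Add (sgE 3) (XV 2)) (XC 2)) (coordE 3 1) (coordE 3 0) (XV 1) (XV 0))).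

(** Both cases are evaluated and the wrong one is multiplied by 0. At t = 0 the truncated difference
    in [recE] merely reads irrelevant cells. *)
Definition walkE :=
  XB Add (XB Mul (isZE 0) (XS 2 baseE))
         (XB Mul (XB Defs.Sub (XC 1) (isZE 0)) (XS 6 (XS 3 (XS 3 recE)))).

Definition powE :=
  let isZ := XB Eqn (XB Div (XV 0) (par 5)) (XC 0) in
  let x := XB Mul (par 4) (XB Mod (XV 0) (par 5)) in
  let r := XG 7 (XB Defs.Sub (XV 0) (par 5)) in
  XB Add (XB Mul isZ (XB Mul (XB Mul x x) (XB Mul x x)))
         (XB Mul (XB Defs.Sub (XC 1) isZ) (XB Mul r r)).

Definition XS4 e := XS 3 (XS 3 (XS 3 (XS 3 e))).

Definition testE :=
  let cell sg := XG 6 (packE (XB Add (XB Mul (par 7) (par 5)) (XV 4)) (XC sg) (XV 3) (XV 2) (XV 1) (XV 0)) in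
  let fl := XS4 (XB Add (XB Mul (cell 0) (cell 0)) (XB Mul (cell 1) (cell 1))) in
  let fr := XS4 (XB Mul (XC 2) (XB Mul (cell 0) (cell 1))) in
  let pw := XG 7 (XB Add (XB Mul (par 7) (par 5)) (XV 0)) in
  let c := XB Mul (XC (2 * g * g)) (par 2) in
  let Qj := XB Mul (par 4) (XV 0) in
  let A := XG 5 (XV 0) in
  let dl := XS 4 (XB Add (XB Mul (XB Mul (par 4) (par 4)) (XB Mul A A)) (XB Mul (XV 1) (XV 1))) in
  let dr := XS 4 (XB Mul (XC 2) (XB Mul (XB Mul (XV 1) (par 4)) A)) in
  XB Mul (XB Mul (XB Leq (XC 1) (XV 0)) (XB Leq fl (XB Add pw fr)))
         (XB Leq (XB Mul c dl) (XB Add (XB Mul Qj Qj) (XB Mul c dr))).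

(* Arrays: 2 sizes (the bounds of loops and sums), 4 binary logarithms,
   5 the tensor A, 6 the matrices M_t for all j, 7 the powers (Q j)^(4 2^t). *)
Definition instructions : seq instr :=
 [:: ISet 2 0 (XB Add (inp 0) (XC 1));
     ISet 2 1 (inp 1);
     ISet 2 2 (xpow NE (odd k));
     ISet 2 3 (xpow NE k./2);
     ISet 2 4 (xpow NE k);
     ISet 2 5 (XB Add (par 4) (XC 1));
     ISet 2 6 (XC 2);
     IFill 4 0 logE;
     ISet 2 7 (XG 4 (XG 4 (inp 0)));
     ISet 2 8 (XB Mul (XB Mul (XB Add (par 7) (XC 1)) (par 5)) (XB Mul (XC 2) (xpow (par 3) 4)));
     ISet 2 9 (XB Mul (XB Add (par 7) (XC 1)) (par 5));
     IFill 5 4 (XS 1 (XB Eqn codeE (XV 1)));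
     IFill 6 8 walkE;
     IFill 7 9 powE;
     ISet 1 0 (XB Leq (XC 1) (XS 5 testE))].

Lemma wf_xpow n e i : wf n e -> wf n (xpow e i).
Proof. by move=> we; elim: i => //= i ->; rewrite we. Qed.

Lemma xeval_xpow s env e i : xeval s env (xpow e i) = xeval s env e ^ i.
Proof. by elim: i => //= i ->; rewrite expnS. Qed.

Lemma wf_codeE n : wf n.+1 codeE.
Proof. by rewrite /codeE; elim: (iota 0 k) => //= i l ->. Qed.

Lemma wf_instructions : all wfi instructions.
Proof. by rewrite /= !wf_xpow // wf_codeE. Qed.

Lemma xevalB s env o e1 e2 :
  xeval s env (XB o e1 e2) = eval_binop o (xeval s env e1) (xeval s env e2).
Proof. by []. Qed.
Lemma xevalC s env c : xeval s env (XC c) = c. Proof. by []. Qed.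
Lemma xevalV s env i : xeval s env (XV i) = nth 0 env i. Proof. by []. Qed.
Lemma xevalG s env a e : xeval s env (XG a e) = s a (xeval s env e). Proof. by []. Qed.
Lemma xevalS s env c e :
  xeval s env (XS c e) = \sum_(i < s 2 c) xeval s (nat_of_ord i :: env) e.
Proof. by []. Qed.
Lemma xeval_par s env i : xeval s env (par i) = s 2 i. Proof. by []. Qed.
Local Arguments xeval : simpl never.
Definition xevalE := (xevalB, xevalC, xevalV, xevalG, xeval_par).

(** * Values of the expressions of the program *)

Section Eval.
Variables (A : nat -> nat) (E D Q : nat) (s : store).
Hypotheses (hE : s 2 2 = E) (hD : s 2 3 = D) (hQ : s 2 4 = Q)
  (hQ1 : s 2 5 = Q.+1) (h2 : s 2 6 = 2).
Hypotheses (D0 : 0 < D) (hA : forall z, z < D * (D * E) -> s 5 z = A z).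

Lemma xeval_zdivE env v i :
  xeval s env (zdivE v i) = iter i (fun z => z %/ D) (nth 0 env v).
Proof. by elim: i => //= i IH; rewrite xevalB xeval_par hD IH. Qed.

Lemma xeval_coordE env v i :
  xeval s env (coordE v i) = iter i (fun z => z %/ D) (nth 0 env v) %% D.
Proof. by rewrite /coordE !xevalE xeval_zdivE hD. Qed.

Lemma xeval_packE env top sg a a' b b' :
  xeval s env (packE top sg a a' b b') =
  pack D (xeval s env top) (xeval s env sg) (xeval s env a) (xeval s env a')
   (xeval s env b) (xeval s env b').
Proof. by rewrite /packE !xevalE hD. Qed.

Lemma xeval_entryE env a b i :
  xeval s env a < D -> xeval s env b < D -> xeval s env i < E ->
  xeval s env (entryE a b i) = A (xeval s env b + D * (xeval s env a + D * xeval s env i)).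
Proof. by move=> aD bD iE; rewrite !xevalE /= hD hA //; nia. Qed.

Lemma xeval_baseE z i : i < E ->
  xeval s [:: i; z] baseE =
  let top := z %/ D %/ D %/ D %/ D %/ 2 in
  let sg := z %/ D %/ D %/ D %/ D %% 2 in
  let a := z %/ D %/ D %/ D %% D in
  let a' := z %/ D %/ D %% D in
  let b := z %/ D %% D in
  let b' := z %% D in
  let j := top %% Q.+1 in
  2 * g * g * Q * (1 - (a == a') * (b == b')) *
      ((1 - sg) * (Q * Q * (A (b + D * (a + D * i)) * A (b' + D * (a' + D * i))) + j * j)
       + sg * (j * Q * (A (b + D * (a + D * i)) + A (b' + D * (a' + D * i))))).
Proof.
move=> iE; rewrite /baseE /topE /sgE.
rewrite !(xevalB, xeval_par, xevalC, xeval_zdivE, xeval_coordE) hQ hQ1.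
by rewrite !xeval_entryE ?xeval_coordE ?ltn_mod.
Qed.

Lemma xeval_walkE z : (forall i, i < z -> s 6 i = walkmx_cell A g E D Q i) ->
  xeval s [:: z] walkE = walkmx_cell A g E D Q z.
Proof.
move=> hX; rewrite /walkE /isZE /topE.
rewrite !(xevalB, xeval_par, xevalC, xeval_zdivE) hQ1 !xevalS hE h2 /=.
rewrite [RHS]/walkmx_cell.
set top := z %/ D %/ D %/ D %/ D %/ 2.
have mD x : x %% D < D by rewrite ltn_mod.
case tE: (top %/ Q.+1) => [|t].
  rewrite mul1n addn0 /=; apply: eq_bigr => i _.
  exact: (xeval_baseE z (ltn_ord i)).
rewrite mul0n add0n mul1n /=; apply: eq_bigr => u _.
rewrite xevalS hD; apply: eq_bigr => e _; rewrite xevalS hD; apply: eq_bigr => e' _.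
have topQ : Q.+1 <= top by rewrite -(divn_gt0 _ (ltn0Sn Q)) tE.
have top1 : (top - Q.+1) %/ Q.+1 = t by rewrite -{1}(mul1n Q.+1) divnBMl tE subn1.
have top2 : (top - Q.+1) %% Q.+1 = top %% Q.+1.
  by rewrite -[in RHS](subnK topQ) modnDr.
have toplt : top - Q.+1 < top by rewrite ltn_subrL (leq_trans _ topQ).
rewrite /recE !(xevalB, xevalG, xeval_packE, xevalV, xeval_par, xeval_coordE,
   xeval_zdivE, xevalC) /= hQ1 -/top.
rewrite !hX; try by apply: pack_lt; rewrite ?ltn_mod.
by rewrite !walkmx_cell_pack ?ltn_mod // top1 top2.
Qed.

Lemma xeval_powE z : (forall i, i < z -> s 7 i = power_cell Q i) ->
  xeval s [:: z] powE = power_cell Q z.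
Proof.
move=> hR; rewrite /powE !(xevalB, xeval_par, xevalC, xevalV, xevalG) hQ hQ1 /=.
rewrite /power_cell; case tE: (z %/ Q.+1) => [|t].
  by rewrite mul1n addn0 /= muln1 !expnS expn0 muln1 !mulnA.
rewrite mul0n add0n mul1n.
have zQ : Q.+1 <= z by rewrite -(divn_gt0 _ (ltn0Sn Q)) tE.
have z1 : (z - Q.+1) %/ Q.+1 = t by rewrite -{1}(mul1n Q.+1) divnBMl tE subn1.
have z2 : (z - Q.+1) %% Q.+1 = z %% Q.+1.
  by rewrite -[in RHS](subnK zQ) modnDr.
have zlt : z - Q.+1 < z by clear -zQ; lia.
by rewrite hR // /power_cell z1 z2 -expnD expnS addnn -!muln2; congr (_ ^ _); clear; lia.
Qed.

Lemma xeval_testE S j : s 2 7 = S -> j < Q.+1 -> Q = D * (D * E) ->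
  (forall z, z < S.+1 * Q.+1 * (2 * D ^ 4) -> s 6 z = walkmx_cell A g E D Q z) ->
  (forall z, z < S.+1 * Q.+1 -> s 7 z = power_cell Q z) ->
  xeval s [:: j] testE =
  (1 <= j) * frobenius_test A g E D Q j S * diagonal_test A g E Q j.
Proof.
move=> hS jQ QE hX hR.
have jS : (S * Q.+1 + j) %/ Q.+1 = S by rewrite divnMDr.
have jS' : (S * Q.+1 + j) %% Q.+1 = j by rewrite modnMDr.
have jlt : S * Q.+1 + j < S.+1 * Q.+1 by clear -jQ; nia.
have cellP sg env (a a' b b' : 'I_D) : sg < 2 ->
  xeval s [:: nat_of_ord b', nat_of_ord b, nat_of_ord a', nat_of_ord a, j & env]
   (XG 6 (packE (XB Add (XB Mul (par 7) (par 5)) (XV 4)) (XC sg) (XV 3) (XV 2) (XV 1) (XV 0)))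
  = walkmx A g E D Q j S sg a a' b b'.
  move=> sg2; rewrite xevalG xeval_packE !xevalE /= hS hQ1 hX.
    by rewrite walkmx_cell_pack // jS jS'.
  rewrite /pack; move: (ltn_ord a) (ltn_ord a') (ltn_ord b) (ltn_ord b').
  move: (nat_of_ord a) (nat_of_ord a') (nat_of_ord b) (nat_of_ord b') => {a a' b b'} a a' b b' ha ha' hb hb'.
  rewrite (_ : S.+1 * Q.+1 * (2 * D ^ 4) = S.+1 * Q.+1 * 2 * D * D * D * D); last by rewrite !expnS expn0; clear; lia.
  have step x y X Y : x < X -> y < Y -> x * Y + y < X * Y by clear; nia.
  do 5![apply: (step) => //].
rewrite /testE !(xevalB, xeval_par, xevalC, xevalV, xevalG) /= hE hQ hQ1 hS.
congr (_ * _ * _).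
  congr (nat_of_bool (_ <= _)).
    rewrite xevalS hD; apply: eq_bigr => a _; rewrite xevalS hD; apply: eq_bigr => a' _.
    rewrite xevalS hD; apply: eq_bigr => b _; rewrite xevalS hD; apply: eq_bigr => b' _.
    by rewrite !(xevalB) !cellP.
  rewrite hR // /power_cell jS jS'; congr (_ + _).
  rewrite xevalS hD; apply: eq_bigr => a _; rewrite xevalS hD; apply: eq_bigr => a' _.
  rewrite xevalS hD; apply: eq_bigr => b _; rewrite xevalS hD; apply: eq_bigr => b' _.
  by rewrite !(xevalB) !cellP.
congr (nat_of_bool (_ <= _)); rewrite xevalS hQ.
  congr (_ * _); apply: eq_bigr => z _.
  by rewrite !xevalE /= hQ hA // -QE.
congr (_ + _ * _); apply: eq_bigr => z _.
by rewrite !xevalE /= hQ hA // -QE.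
Qed.

End Eval.
End Program.

(** * Polynomial bounds on table sizes and entries *)

Definition poly_bounded (f : nat -> nat -> nat) :=
  exists a d, forall n m, f n m <= a * (n + m).+1 ^ d.

Lemma poly_bounded_leq f h : (forall n m, f n m <= h n m) ->
  poly_bounded h -> poly_bounded f.
Proof. by move=> fh [a [d hb]]; exists a, d => n m; apply: leq_trans (hb n m). Qed.

Lemma poly_bounded_const c : poly_bounded (fun _ _ => c).
Proof. by exists c, 0 => n m; rewrite muln1. Qed.

Lemma poly_bounded_fst : poly_bounded (fun n _ => n).
Proof. by exists 1, 1 => n m; rewrite expn1 mul1n; lia. Qed.

Lemma poly_bounded_snd : poly_bounded (fun _ m => m).
Proof. by exists 1, 1 => n m; rewrite expn1 mul1n; lia. Qed.

Lemma poly_boundedD f h : poly_bounded f -> poly_bounded h ->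
  poly_bounded (fun n m => f n m + h n m).
Proof.
move=> [a [d fb]] [a' [d' hb]]; exists (a + a'), (d + d') => n m.
rewrite mulnDl; apply: leq_add.
  by apply: leq_trans (fb n m) _; apply: leq_cexp => //; exact: leq_addr.
by apply: leq_trans (hb n m) _; apply: leq_cexp => //; exact: leq_addl.
Qed.

Lemma poly_boundedM f h : poly_bounded f -> poly_bounded h ->
  poly_bounded (fun n m => f n m * h n m).
Proof.
move=> [a [d fb]] [a' [d' hb]]; exists (a * a'), (d + d') => n m.
by rewrite expnD mulnACA leq_mul.
Qed.

Lemma poly_boundedX f e : poly_bounded f -> poly_bounded (fun n m => f n m ^ e).
Proof.
move=> pf; elim: e => [|e IH]; first exact: poly_bounded_const 1.
apply: (@poly_bounded_leq _ (fun n m => f n m * f n m ^ e)).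
  by move=> n m; rewrite expnS.
exact: poly_boundedM.
Qed.

Lemma expn_lt_exp2 x e : 0 < e -> x ^ e < 2 ^ (x * e).
Proof. by move=> e0; rewrite expnM ltn_exp2r // ltn_expl. Qed.

Definition walkmx_base g E D Q m :=
  E * (2 * g * g * Q * (Q * Q * (m * m) + Q * Q + Q * Q * (m + m))) + 2 * (D * D) + 1.

(** The exponents satisfy e_0 = 1 and e_(t+1) = 2 e_t + 1: an entry of the next level is a sum of 2
    D^2 products of two entries, and [walkmx_base] is at least 2 D^2. *)
Lemma walkmx_le A g E D Q m j t sg a a' b b' :
  (forall z, A z <= m) -> j <= Q -> sg < 2 ->
  walkmx A g E D Q j t sg a a' b b' <= walkmx_base g E D Q m ^ (2 ^ t.+1).-1.
Proof.
move=> Am jQ; set Y := walkmx_base _ _ _ _ _.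
elim: t sg a a' b b' => [|t IH] sg a a' b b' sg2.
  rewrite /= expn1 /Y /walkmx_base.
  apply: leq_trans (_ : E * (2 * g * g * Q * (Q * Q * (m * m) + Q * Q + Q * Q * (m + m))) <= _); last by lia.
  rewrite -[E in leqRHS]card_ord -sum_nat_const; apply: leq_sum => i _.
  have lem x y u v : x <= 1 -> u <= v -> y * x * u <= y * v.
    by move=> x1 uv; rewrite -mulnA leq_mul2l -[v]mul1n leq_mul ?orbT.
  apply: lem; first by lia.
  set x := A _; set y := A _.
  have hx : x <= m by exact: Am.
  have hy : y <= m by exact: Am.
  have h1 : Q * Q * (x * y) <= Q * Q * (m * m) by rewrite leq_mul2l leq_mul ?orbT.
  have h2 : j * j <= Q * Q by exact: leq_mul.
  have h3 : j * Q * (x + y) <= Q * Q * (m + m) by rewrite !leq_mul // leq_add.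
  by case: sg sg2 => [|[|//]] _; lia.
have h u v e e' : u < 2 -> v < 2 ->
   walkmx A g E D Q j t u a a' e e' * walkmx A g E D Q j t v b b' e e' <=
   Y ^ (2 ^ t.+1).-1.*2.
  by move=> u2 v2; rewrite -addnn expnD; apply: leq_mul; apply: IH.
rewrite /=; apply: (@leq_trans (\sum_(u < 2) \sum_(e < D) \sum_(e' < D) Y ^ (2 ^ t.+1).-1.*2)).
  apply: leq_sum => u _; apply: leq_sum => e _; apply: leq_sum => e' _.
  by apply: h; rewrite ?ltn_mod.
rewrite !sum_nat_const !card_ord !mulnA.
have -> : (2 ^ t.+2).-1 = (2 ^ t.+1).-1.*2.+1.
  by rewrite (expnS 2 t.+1); have := expn_gt0 2 t.+1; case: (2 ^ t.+1) => //= x _; lia.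
rewrite [leqRHS]expnS; apply: leq_mul => //; rewrite /Y /walkmx_base; lia.
Qed.

Definition code_at q k (inp : nat -> nat) N r :=
  foldr (fun i acc => (inp (2 + i + 2 * k * r) * q + inp (2 + (k + i) + 2 * k * r)) + N * acc)
    0 (iota 0 k).

Lemma xeval_codeE q k s r env n : s 0 0 = n ->
  xeval s (r :: env) (codeE q k) = code_at q k (s 0) (q * n) r.
Proof.
move=> hn; rewrite /codeE /code_at; elim: (iota 0 k) => //= i l ->.
by rewrite hn.
Qed.

(** The number s + 1 of levels and the power 2^s are both at most n + 2. The last two summands bound
    the lengths of the entries of arrays 6 and 7, using the crude estimate x^e < 2^(x e). *)
Definition size_bound q k g n m :=
  let N := q * n in
  let E := N ^ odd k in let D := N ^ k./2 in let Q := N ^ k in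
  n + m + q + 10 + E + D + Q + (n + 2) * (Q + 1) * (2 * D ^ 4) + (n + 2) * (Q + 1) +
  walkmx_base g E D Q m * (2 * (n + 2)) + Q * Q * (4 * (n + 2)).

Lemma poly_size_bound q k g : poly_bounded (size_bound q k g).
Proof.
rewrite /size_bound /walkmx_base.
do ?[apply: poly_boundedD | apply: poly_boundedM | apply: poly_boundedX
  | exact: poly_bounded_const | exact: poly_bounded_fst | exact: poly_bounded_snd].
Qed.

Lemma leq_exp2 a b : a <= b -> a < 2 ^ b.
Proof. by move=> ab; apply: leq_ltn_trans ab (ltn_expl _ _). Qed.

Lemma trunc_log_le n : trunc_log 2 n <= n.
Proof.
case: n => [|n]; first by rewrite trunc_log0.
by apply: ltnW; apply: leq_trans (ltn_expl _ (isT : 1 < 2)) (trunc_logP _ _).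
Qed.

(** Only log log n squarings are made, so the exponents 2^s, and with them the lengths of the
    entries, stay polynomial. *)
Lemma exp2_loglog n : 2 ^ trunc_log 2 (trunc_log 2 n) <= n.+1.
Proof.
case: (posnP (trunc_log 2 n)) => [->|h]; first by rewrite trunc_log0.
by apply: leq_trans (trunc_logP _ h) _ => //; rewrite leqW ?trunc_log_le.
Qed.

Lemma instructions_run q k g n m (sg0 : store) :
  let N := q * n in
  let E := N ^ odd k in let D := N ^ k./2 in let Q := N ^ k in
  let A z := \sum_(r < m) (code_at q k (sg0 0) N r == z) in
  sg0 0 0 = n -> sg0 0 1 = m ->
  (forall a i, a != 0 -> sg0 a i = 0) -> (forall i, sg0 0 i <= n + m + q + 2) ->
  bounded (size_bound q k g n m) sg0 /\
  exists sg', runs (size_bound q k g n m) sg0 (instructions q k g) sg' /\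
    sg' 1 0 = accepts A g E D Q (trunc_log 2 (trunc_log 2 n)).
Proof.
move=> N E D Q A hn hm h0 hin; set G := size_bound _ _ _ _ _.
have GE : G = n + m + q + 10 + E + D + Q + (n + 2) * (Q + 1) * (2 * D ^ 4) + (n + 2) * (Q + 1) +
  walkmx_base g E D Q m * (2 * (n + 2)) + Q * Q * (4 * (n + 2)) by [].
have QE : Q = D * (D * E).
  by rewrite /Q /D /E mulnA -!expnD addnn addnC odd_double_half.
set s := trunc_log 2 (trunc_log 2 n).
have sn : s <= n by apply: leq_trans (trunc_log_le _) (trunc_log_le _).
have bd0 : bounded G sg0.
  split=> [c|a i a3]; first by rewrite h0.
  by case: (eqVneq a 0) => [->|a0]; [apply: leq_exp2; apply: leq_trans (hin i) _; lia
    | rewrite h0 // expn_gt0].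
have smallP x : x <= G -> x < 2 ^ G by exact: leq_exp2.
have Ale z : A z <= m.
  rewrite /A -[m in leqRHS]card_ord -sum1_card; apply: leq_sum => r _; exact: leq_b1.
split=> //.
pose lenX := (s + 1) * (Q + 1) * (2 * D ^ 4).
pose lenR := (s + 1) * (Q + 1).
have lenXG : lenX <= G.
  apply: (@leq_trans ((n + 2) * (Q + 1) * (2 * D ^ 4))); last by rewrite GE; clear; lia.
  by rewrite /lenX !leq_mul //; lia.
have lenRG : lenR <= G.
  apply: (@leq_trans ((n + 2) * (Q + 1))); last by rewrite GE; clear; lia.
  by rewrite /lenR leq_mul //; lia.
pose s1 := update sg0 2 0 (n + 1).
pose s2 := update s1 2 1 m.
pose s3 := update s2 2 2 E.
pose s4 := update s3 2 3 D.
pose s5 := update s4 2 4 Q.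
pose s6 := update s5 2 5 (Q + 1).
pose s7 := update s6 2 6 2.
(* The length n + 1 lets the table of logarithms reach n itself. *)
pose s8 := filled s7 4 (n + 1) (trunc_log 2).
pose s9 := update s8 2 7 s.
pose s10 := update s9 2 8 lenX.
pose s11 := update s10 2 9 lenR.
pose s12 := filled s11 5 Q A.
pose s13 := filled s12 6 lenX (walkmx_cell A g E D Q).
pose s14 := filled s13 7 lenR (power_cell Q).
pose s15 := update s14 1 0 (accepts A g E D Q s).
have b1 : bounded G s1 by apply: bounded_update; rewrite ?smallP // GE; clear -sn; lia.
have b2 : bounded G s2 by apply: bounded_update; rewrite ?smallP // GE; clear -sn; lia.
have b3 : bounded G s3 by apply: bounded_update; rewrite ?smallP // GE; clear -sn; lia.
have b4 : bounded G s4 by apply: bounded_update; rewrite ?smallP // GE; clear -sn; lia.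
have b5 : bounded G s5 by apply: bounded_update; rewrite ?smallP // GE; clear -sn; lia.
have b6 : bounded G s6 by apply: bounded_update; rewrite ?smallP // GE; clear -sn; lia.
have b7 : bounded G s7 by apply: bounded_update; rewrite ?smallP // GE; clear -sn; lia.
have b8 : bounded G s8.
  apply: bounded_filled => // z zn; apply: smallP; apply: leq_trans (trunc_log_le _) _.
  by rewrite GE; clear -zn; lia.
have b9 : bounded G s9 by apply: bounded_update; rewrite ?smallP // GE; clear -sn; lia.
have b10 : bounded G s10 by apply: bounded_update; rewrite ?smallP.
have b11 : bounded G s11 by apply: bounded_update; rewrite ?smallP.
have b12 : bounded G s12.
  by apply: bounded_filled => // z zn; apply: smallP; apply: leq_trans (Ale _) _; rewrite GE; clear; lia.
have e2s t : t <= s -> 2 ^ t <= n + 1.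
  by move=> ts; rewrite addn1; apply: leq_trans (exp2_le ts) (exp2_loglog n).
have b13 : bounded G s13.
  apply: bounded_filled => // z zn; rewrite /walkmx_cell; set top := _ %/ 2.
  have tops : top %/ Q.+1 <= s.
    suff : top %/ Q.+1 < s + 1 by rewrite addn1.
    rewrite ltn_divLR // /top -!divnMA.
    (* For D = 0 the table has length 0, so there is no index [z]. *)
    have [D0|D0] := posnP D; first by move: zn; rewrite /lenX D0 exp0n // !muln0.
    rewrite ltn_divLR ?muln_gt0 ?D0 //; move: zn; rewrite /lenX -[Q.+1]addn1 !expnS expn0 muln1; lia.
  apply: leq_ltn_trans (walkmx_le (m := m) _ _ _ _ _ _ _ _ _ _ _) _ => //.
  - by rewrite -ltnS ltn_mod.
  - by rewrite ltn_mod.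
  set Y := walkmx_base _ _ _ _ _.
  have Y0 : 0 < Y by rewrite /Y /walkmx_base addn1.
  apply: (@leq_ltn_trans (Y ^ (2 * (n + 2)))).
    have et := e2s _ tops; have le : (2 ^ (top %/ Q.+1).+1).-1 <= 2 * (n + 2).
      by rewrite expnS; move: et; move: (2 ^ _) => x; clear; lia.
    by rewrite leq_pexp2l.
  apply: leq_trans (expn_lt_exp2 _ _) (exp2_le _); first by rewrite addn2.
  by rewrite GE -/Y; clear; lia.
have b14 : bounded G s14.
  apply: bounded_filled => // z zn; rewrite /power_cell.
  have ts : z %/ Q.+1 <= s.
    by suff : z %/ Q.+1 < s + 1; [rewrite addn1 | rewrite ltn_divLR // -[Q.+1]addn1].
  have jQ : z %% Q.+1 <= Q by rewrite -ltnS ltn_mod.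
  apply: (@leq_ltn_trans ((Q * Q) ^ (4 * 2 ^ (z %/ Q.+1)))).
    by rewrite leq_exp2r ?muln_gt0 ?expn_gt0 // leq_mul2l jQ orbT.
  have p0 : 0 < 2 ^ (z %/ Q.+1) by rewrite expn_gt0.
  apply: leq_trans (expn_lt_exp2 _ _) (exp2_le _); first by rewrite muln_gt0 p0.
  apply: (@leq_trans (Q * Q * (4 * (n + 2)))); last by rewrite GE; clear; lia.
  have et := e2s _ ts; rewrite leq_mul2l leq_mul2l; apply/orP; right.
  by move: et; move: (2 ^ _) => x; clear; lia.
have b15 : bounded G s15.
  apply: bounded_update => //; apply: smallP; apply: leq_trans (leq_b1 _) _; rewrite GE; clear; lia.
exists s15; split; last by rewrite /s15 update_eq.
have st1 : istep sg0 (ISet 2 0 (XB Add (inp 0) (XC 1))) s1 by rewrite /= hn.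
have st2 : istep s1 (ISet 2 1 (inp 1)) s2 by rewrite /= /s1 /update /= hm.
have NEE sg : sg 0 0 = n -> xeval sg [::] (NE q) = N by move=> /= ->.
have st3 : istep s2 (ISet 2 2 (xpow (NE q) (odd k))) s3.
  by rewrite /istep xeval_xpow NEE.
have st4 : istep s3 (ISet 2 3 (xpow (NE q) k./2)) s4.
  by rewrite /istep xeval_xpow NEE.
have st5 : istep s4 (ISet 2 4 (xpow (NE q) k)) s5.
  by rewrite /istep xeval_xpow NEE.
have st6 : istep s5 (ISet 2 5 (XB Add (par 4) (XC 1))) s6 by [].
have st7 : istep s6 (ISet 2 6 (XC 2)) s7 by [].
have st8 : istep s7 (IFill 4 0 logE) s8.
  exists (trunc_log 2) => // z zn; rewrite /logE /= /filled /=.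
  case: (ltnP 1 z) => z1 /=; last by case: z z1 {zn} => [|[|]] //; rewrite mul0n ?trunc_log0 ?trunc_log1.
  rewrite mul1n ltn_Pdiv //; last by clear -z1; lia.
  by rewrite [RHS]trunc_log2S // divn2 add1n.
have st9 : istep s8 (ISet 2 7 (XG 4 (XG 4 (inp 0)))) s9.
  rewrite /= /s9 (_ : s8 0 0 = n) //; congr (update _ _ _ _).
  by rewrite /s8 /filled /= !addn1 !ltnS leqnn trunc_log_le.
have st10 : istep s9 (ISet 2 8 (XB Mul (XB Mul (XB Add (par 7) (XC 1)) (par 5)) (XB Mul (XC 2) (xpow (par 3) 4)))) s10.
  by rewrite /istep /s10 /= muln1.
have st11 : istep s10 (ISet 2 9 (XB Mul (XB Add (par 7) (XC 1)) (par 5))) s11 by [].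
have st12 : istep s11 (IFill 5 4 (XS 1 (XB Eqn (codeE q k) (XV 1)))) s12.
  exists A => // z zQ; rewrite xevalS; apply: eq_bigr => r _.
  by rewrite xevalB (@xeval_codeE _ _ _ _ _ n).
have st13 : istep s12 (IFill 6 8 (walkE g)) s13.
  exists (walkmx_cell A g E D Q) => // z zX.
  apply: xeval_walkE => //.
  - by rewrite -[Q.+1]addn1.
  - case: (posnP D) => // D0; move: zX.
    by rewrite (_ : s12 2 8 = lenX) // /lenX D0 exp0n // !muln0.
  - by move=> y yQ; rewrite /s12 /filled /= QE yQ.
  - by move=> y yz; rewrite /filled /= yz.
have st14 : istep s13 (IFill 7 9 powE) s14.
  exists (power_cell Q) => // z zX.
  apply: xeval_powE => //; first by rewrite -[Q.+1]addn1.
  by move=> y yz; rewrite /filled /= yz.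
have st15 : istep s14 (ISet 1 0 (XB Leq (XC 1) (XS 5 (testE g)))) s15.
  rewrite /istep /s15 /accepts; congr (update _ _ _ _).
  rewrite xevalB xevalS (_ : s14 2 5 = Q.+1); last by rewrite -[Q.+1]addn1.
  congr (nat_of_bool (0 < _)); apply: eq_bigr => j _.
  rewrite (@xeval_testE g A E D Q s14 _ _ _ _ _ s) //.
  - by rewrite -[Q.+1]addn1.
  - by move=> y yQ; rewrite /s14 /s13 /s12 /filled /= QE yQ.
  - by move=> y; rewrite -[s.+1]addn1 -[Q.+1]addn1 => yX; rewrite /s14 /s13 /filled /= yX.
  - by move=> y; rewrite -[s.+1]addn1 -[Q.+1]addn1 => yX; rewrite /s14 /filled /= yX.
exists s1; split=> //; exists s2; split=> //; exists s3; split=> //; exists s4; split=> //.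
exists s5; split=> //; exists s6; split=> //; exists s7; split=> //; exists s8; split=> //.
exists s9; split=> //; exists s10; split=> //; exists s11; split=> //; exists s12; split=> //.
exists s13; split=> //; exists s14; split=> //; exists s15; split=> //.
Qed.

(** * The input read as a tensor of occurrences *)

Lemma nth_flatten_uniform (T : Type) (x0 : T) (w : nat) (ss : seq (seq T)) r i :
  (forall j, j < size ss -> size (nth [::] ss j) = w) -> r < size ss -> i < w ->
  nth x0 (flatten ss) (i + w * r) = nth x0 (nth [::] ss r) i.
Proof.
elim: ss r => //= s ss IH [|r] hs rs iw.
  by rewrite muln0 addn0 nth_cat (hs 0) // iw.
rewrite nth_cat (hs 0) // mulnS addnCA ltnNge leq_addr /= addKn IH //.
by move=> j js; exact: (hs j.+1).
Qed.

Section Encoding.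
Variables q k n : nat.
Implicit Types (I : instance q k n) (ct : constraint q k n).

Definition digit ct (i : 'I_k) : nat := ct.2 i * q + ct.1 i.

Definition code_digits ct (s : seq 'I_k) :=
  foldr (fun i acc => digit ct i + q * n * acc) 0 s.

Definition code ct := code_digits ct (enum 'I_k).

Definition block ct :=
  codom (fun i => ct.2 i : nat) ++ codom (fun i => ct.1 i : nat).

Lemma nth_block_var ct (i : 'I_k) : nth 0 (block ct) i = ct.2 i.
Proof.
rewrite nth_cat size_map size_enum_ord ltn_ord /codom /image_mem.
by rewrite (nth_map i) ?size_enum_ord // nth_ord_enum.
Qed.

Lemma nth_block_shift ct (i : 'I_k) : nth 0 (block ct) (k + i) = ct.1 i.
Proof.
rewrite nth_cat size_map size_enum_ord ltnNge leq_addr /= addKn /codom /image_mem.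
by rewrite (nth_map i) ?size_enum_ord // nth_ord_enum.
Qed.

Lemma nth_encode I (r : 'I_(size I)) i : i < 2 * k ->
  nth 0 (encode I) (2 + i + 2 * k * r) = nth 0 (block (tnth (in_tuple I) r)) i.
Proof.
move=> ik; rewrite /encode -addnA add2n /=.
rewrite nth_flatten_uniform ?size_map //.
  by rewrite (nth_map (tnth (in_tuple I) r)) // -(tnth_nth _ (in_tuple I)).
move=> j js; rewrite (nth_map (tnth (in_tuple I) r)) //.
by rewrite size_cat !size_codom !card_ord mul2n addnn.
Qed.

Lemma code_at_encode I (r : 'I_(size I)) :
  code_at q k (input I 0) (q * n) r = code (tnth (in_tuple I) r).
Proof.
have := @nth_encode I r; have -> : nth 0 (encode I) = input I 0 by [].
move: (input I 0) => F hF.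
rewrite /code_at -(val_enum_ord k) /code /code_digits.
elim: (enum 'I_k) => //= i s ->.
rewrite hF ?nth_block_var; last by rewrite (leq_trans (ltn_ord i)) // mul2n -addnn leq_addr.
by rewrite hF ?nth_block_shift // mul2n -addnn ltn_add2l.
Qed.

Definition occurrences I z := count (fun ct => code ct == z) I.

Lemma sum_code_at I z :
  \sum_(r < size I) (code_at q k (input I 0) (q * n) r == z) = occurrences I z.
Proof.
rewrite /occurrences -sum1_count [RHS]big_mkcond /= [RHS]big_tnth.
by apply: eq_bigr => r _; rewrite code_at_encode; case: (_ == _).
Qed.

Lemma mem_encode I x : x \in encode I -> x <= n + size I + q + 2.
Proof.
rewrite /encode !inE => /or3P[/eqP->|/eqP->|/flattenP[s /mapP[ct _ ->]]]; try lia.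
rewrite mem_cat => /orP[] /codomP[i ->].
  by have := ltn_ord (ct.2 i); lia.
(* The type ['Z_q] has two elements even for q < 2; the summand 2 of the bound covers this case. *)
by have := ltn_ord (ct.1 i); rewrite /Zp_trunc; lia.
Qed.

Definition certified g I : bool :=
  accepts (occurrences I) g ((q * n) ^ odd k) ((q * n) ^ k./2) ((q * n) ^ k)
    (trunc_log 2 (trunc_log 2 n)).

End Encoding.

Definition certifier q k g := program (instructions q k g).

Lemma certifier_exec q k g : exists a d, forall n (I : instance q k n),
  exists s' t, [/\ exec (certifier q k g) (input I) s' t,
    s' 1 0 = certified g I & t <= a * (n + size I).+1 ^ d].
Proof.
have [C [d h]] := program_exec (wf_instructions q k g).
have [a [e hb]] : poly_bounded (fun n m => C * size_bound q k g n m ^ d).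
  apply: poly_boundedM; first exact: poly_bounded_const.
  by apply: poly_boundedX; exact: poly_size_bound.
exists a, e => n I.
have [||||bd [sg' [rn out]]] := @instructions_run q k g n (size I) (input I).
- by [].
- by [].
- by move=> b i b0; rewrite /input (negPf b0).
- move=> i; rewrite /input /=.
  case: (ltnP i (size (encode I))) => [il|il]; last by rewrite nth_default.
  by apply: mem_encode; rewrite mem_nth.
have G0 : 0 < size_bound q k g n (size I) by rewrite /size_bound; lia.
have [s' [t [ex ag tb]]] := h _ _ _ _ G0 bd (fun _ _ _ => erefl) rn.
exists s', t; split=> //; last exact: leq_trans tb (hb _ _).
rewrite ag // out /certified; congr (nat_of_bool (accepts _ _ _ _ _ _)).
by apply/funext => z; rewrite sum_code_at.
Qed.

Lemma certifier_poly_time q k g : poly_time q k (certifier q k g).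
Proof.
have [a [d h]] := certifier_exec q k g; exists a, d => n I.
by have [s' [t [ex _ tb]]] := h n I; exists s', t.
Qed.

Lemma certifier_certifies q k g n (I : instance q k n) :
  certifies (certifier q k g) I <-> certified g I.
Proof.
have [a [d h]] := certifier_exec q k g; have [s' [t [ex out _]]] := h n I.
split=> [[s2 [t2 [ex2]]]|c].
  by rewrite (exec_deterministic ex ex2) out; case: (certified g I).
by exists s', t; rewrite out c.
Qed.

Local Open Scope ring_scope.

(** * Expectations over a random set of constraints *)

Section Expectation.
Variables (R : realType) (C : finType) (p : R).
Hypothesis p01 : 0 <= p <= 1.

Definition expect (f : {set C} -> R) : R :=
  \sum_(S : {set C}) p ^+ #|S| * (1 - p) ^+ #|~: S| * f S.

Lemma weight_ge0 (S : {set C}) : 0 <= p ^+ #|S| * (1 - p) ^+ #|~: S|.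
Proof. by case/andP: p01 => p0 p1; rewrite mulr_ge0 ?exprn_ge0 ?subr_ge0. Qed.

Lemma expect_sum (J : finType) (P : pred J) (F : J -> {set C} -> R) :
  expect (fun S => \sum_(j | P j) F j S) = \sum_(j | P j) expect (F j).
Proof.
rewrite /expect exchange_big /=; apply: eq_bigr => S _.
by rewrite mulr_sumr.
Qed.

Lemma expectZ (c : R) f : expect (fun S => c * f S) = c * expect f.
Proof. by rewrite /expect mulr_sumr; apply: eq_bigr => S _; rewrite mulrCA. Qed.

Lemma eq_expect f g : f =1 g -> expect f = expect g.
Proof. by move=> fg; apply: eq_bigr => S _; rewrite fg. Qed.

Lemma weight_prod (S : {set C}) :
  p ^+ #|S| * (1 - p) ^+ #|~: S| = \prod_(z : C) (if z \in S then p else 1 - p).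
Proof.
rewrite (bigID (fun z => z \in S)) /=; congr (_ * _).
  by rewrite (eq_bigr (fun=> p)) ?prodr_const // => z ->.
rewrite (eq_bigr (fun=> 1 - p)) => [|z /negPf -> //].
rewrite (eq_bigl (fun z => z \in ~: S)) ?prodr_const // => z.
by rewrite inE.
Qed.

(** Independence: expanding the product of two-term sums yields one term for each subset. *)
Lemma expect_prod (F : C -> bool -> R) :
  expect (fun S => \prod_(z : C) F z (z \in S)) =
  \prod_(z : C) (p * F z true + (1 - p) * F z false).
Proof.
rewrite bigA_distr /expect; apply: eq_big => [S|S _]; first by rewrite inE.
rewrite weight_prod -big_split /=; apply: eq_bigr => z _.
by case: (z \in S).
Qed.

Lemma expect1 : expect (fun=> 1) = 1.
Proof.
rewrite (@eq_expect _ (fun S => \prod_(z : C) (fun (_ : C) (_ : bool) => 1) z (z \in S))).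
  by rewrite (expect_prod (fun _ _ => 1)) big1 // => z _; rewrite !mulr1 addrC subrK.
by move=> S; rewrite big1.
Qed.

(** Markov's inequality, in the form where failure of the event [P] forces [f] to be large. *)
Lemma markov_expect (f : {set C} -> R) (P : pred {set C}) (t : R) :
  0 < t -> (forall S, 0 <= f S) -> (forall S, ~~ P S -> t <= f S) ->
  1 - expect f / t <= \sum_(S | P S) p ^+ #|S| * (1 - p) ^+ #|~: S|.
Proof.
move=> t0 f0 ft; rewrite lerBlDr -{1}expect1 /expect (bigID P) /=.
apply: lerD; first by apply: ler_sum => S _; rewrite mulr1.
rewrite mulr_suml [leRHS](bigID P) /= -[leLHS]add0r; apply: lerD.
  by apply: sumr_ge0 => S _; rewrite mulr_ge0 ?invr_ge0 ?(ltW t0) // mulr_ge0 ?weight_ge0 ?f0.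
apply: ler_sum => S PS; rewrite -[leRHS]mulrA ler_wpM2l ?weight_ge0 //.
by rewrite ler_pdivlMr // mul1r ft.
Qed.

Lemma prod_seq_count (T : finType) (K : comPzRingType) (F : T -> K) (zs : seq T) :
  \prod_(z <- zs) F z = \prod_(z : T) F z ^+ count_mem z zs.
Proof.
elim: zs => [|y zs IH]; first by rewrite big_nil big1.
rewrite big_cons IH (bigD1 y) //= [RHS](bigD1 y) //= eqxx exprS mulrA.
congr (_ * _); apply: eq_bigr => z zy.
by rewrite eq_sym (negPf zy) add0n.
Qed.

Lemma sum_count_mem (T : finType) (zs : seq T) :
  (\sum_(z : T) count_mem z zs)%N = size zs.
Proof.
elim: zs => [|y zs IH] /=; first by rewrite big1.
rewrite big_split /= IH (bigD1 y) //= eqxx big1 // => z zy.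
by rewrite eq_sym (negPf zy).
Qed.

Variables (rho lam x : R).
Hypotheses (rho0 : 0 <= rho) (rhop : rho <= p) (rhox : p - rho <= x)
  (lam1 : 1 <= lam) (px : p <= lam ^+ 2 * x).

Let x0 : 0 <= x.
Proof. by apply: le_trans rhox; rewrite subr_ge0. Qed.

(** The centre [rho] is only close to [p], so the first moment is p - rho instead of 0, and it is at
    most x. For c >= 2 both deviations are at most 1 in absolute value, so the second moment is a
    bound; it is at most p, hence at most lam^2 x. *)
Lemma centered_moment c : (0 < c)%N ->
  `|p * (1 - rho) ^+ c + (1 - p) * (0 - rho) ^+ c| <= lam ^+ c * x.
Proof.
case/andP: p01 => p0 p1.
case: c => [//|[|c]] _.
  have -> : p * (1 - rho) ^+ 1 + (1 - p) * (0 - rho) ^+ 1 = p - rho by rewrite !expr1; ring.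
  by rewrite ger0_norm ?subr_ge0 // expr1 (le_trans rhox) // ler_peMl.
have r1 : 0 <= 1 - rho <= 1 by rewrite subr_ge0 (le_trans rhop p1) /= gerBl.
have r2 : `|0 - rho| <= 1 by rewrite sub0r normrN ger0_norm ?(le_trans rhop).
have l2 : lam ^+ 2 * x <= lam ^+ c.+2 * x.
  by rewrite ler_wpM2r // ler_weXn2l.
apply: le_trans l2; apply: le_trans px.
apply: le_trans (ler_normD _ _) _.
rewrite (normrM p) (normrM (1 - p)) !normrX (ger0_norm p0) (@ger0_norm _ (1 - p)) ?subr_ge0 //.
have h1 : `|1 - rho| ^+ c.+2 <= `|1 - rho| ^+ 2.
  by apply: ler_wiXn2l; rewrite ?normr_ge0 // ger0_norm; case/andP: r1.
have h2 : `|0 - rho| ^+ c.+2 <= `|0 - rho| ^+ 2.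
  by apply: ler_wiXn2l; rewrite ?normr_ge0.
have e1 : `|1 - rho| ^+ 2 = (1 - rho) ^+ 2 by rewrite -normrX ger0_norm ?sqr_ge0.
have e2 : `|0 - rho| ^+ 2 = rho ^+ 2 by rewrite sub0r normrN -normrX ger0_norm ?sqr_ge0.
apply: (@le_trans _ _ (p * (1 - rho) ^+ 2 + (1 - p) * rho ^+ 2)).
  by apply: lerD; apply: ler_wpM2l; rewrite ?subr_ge0 // -?e1 -?e2.
rewrite (_ : _ + _ = p - (rho * (p - rho) + rho * p)); last by ring.
by rewrite gerBl addr_ge0 // mulr_ge0 // subr_ge0.
Qed.

(** Independence groups the factors by element. An element of multiplicity c > 0 contributes at most
    lam^c x, so x is gained once for each distinct element. *)
Lemma expect_centered_prod (zs : seq C) :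
  `|expect (fun S => \prod_(z <- zs) ((z \in S)%:R - rho))| <=
  lam ^+ size zs * x ^+ #|[set z in zs]|.
Proof.
rewrite (@eq_expect _ (fun S => \prod_(z : C)
    (fun z (b : bool) => (b%:R - rho) ^+ count_mem z zs) z (z \in S))); last first.
  by move=> S; rewrite prod_seq_count.
rewrite (expect_prod (fun z b => (b%:R - rho) ^+ count_mem z zs)) normr_prod.
apply: (@le_trans _ _ (\prod_(z : C) (lam ^+ count_mem z zs * (if z \in zs then x else 1)))).
  apply: ler_prod => z _; rewrite normr_ge0 /=.
  case: ifP => [|/negP/negP] zzs; first by apply: centered_moment; rewrite -has_count has_pred1.
  by rewrite (count_memPn zzs) !expr0 !mulr1 addrC subrK normr1.
rewrite big_split /= prodrXr sum_count_mem -big_mkcond /=.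
by rewrite prodr_const cardsE.
Qed.

End Expectation.

(** * Moments of the random matrices *)

Section Walks.
Variables (R : realType) (TE TD : finType).
Implicit Types (T : TE * TD * TD -> R) (x y z w : TD * TD).

Definition distinct_pairs x z : bool := ~~ ((x.1 == x.2) && (z.1 == z.2)).

Definition pairmx T x z : R :=
  (distinct_pairs x z)%:R * \sum_(i : TE) T (i, x.1, z.1) * T (i, x.2, z.2).

(** Entry of (M M^T)^l for M = [pairmx T], unfolded so that each level of the recursion adds one
    step z, w to the walk. *)
Fixpoint gram_pow T l x y : R :=
  if l is l'.+1 then
    \sum_z \sum_w pairmx T x z * pairmx T w z * gram_pow T l' w y
  else (x == y)%:R.

(** Each distinct vertex pays 1/|K|, which offsets its |K| possible values in a sum over walks. *)
Definition weight (K : finType) (V : {set K}) : R := (#|K|%:R)^-1 ^+ #|V|.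

Lemma weight_set_ge0 (K : finType) (V : {set K}) : 0 <= weight V.
Proof. by rewrite exprn_ge0 // invr_ge0. Qed.

(** Each of the |V| choices inside V keeps the weight. The choices outside V lose a factor |K| each
    and together count for at most one more. *)
Lemma sum_weight_setU1 (K : finType) (V : {set K}) (r : nat) : (#|V| < r)%N ->
  \sum_(c : K) weight (c |: V) <= weight V * r%:R.
Proof.
move=> Vr; rewrite (bigID (fun c => c \in V)) /=.
rewrite (eq_bigr (fun=> weight V)); last first.
  by move=> c cV; rewrite (finset.setUidPr _) // finset.sub1set.
rewrite [X in _ + X](eq_bigr (fun=> weight V * #|K|%:R^-1)); last first.
  by move=> c cV; rewrite /weight cardsU1 cV add1n exprSr.
rewrite !sumr_const.
apply: (@le_trans _ _ (weight V *+ #|V| + weight V)).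
  rewrite lerD2l -[_ / _ *+ _]mulr_natr -mulrA ler_piMr ?weight_set_ge0 //.
  have [K0|K0] := posnP #|K|; first by rewrite K0 invr0 mul0r.
  rewrite mulrC ler_pdivrMr ?ltr0n // mul1r ler_nat; exact: max_card.
by rewrite -mulrSr -[_ *+ _]mulr_natr ler_wpM2l ?weight_set_ge0 // ler_nat.
Qed.

Lemma sum_weight_setU2 (K : finType) (V : {set K}) (r : nat) : (#|V|.+1 < r)%N ->
  \sum_(c : K) \sum_(c' : K) weight (c |: (c' |: V)) <= weight V * r%:R ^+ 2.
Proof.
move=> Vr; rewrite exchange_big /= expr2 mulrA.
apply: (@le_trans _ _ (\sum_(c' : K) weight (c' |: V) * r%:R)).
  apply: ler_sum => c' _; apply: sum_weight_setU1.
  by apply: leq_ltn_trans Vr; rewrite cardsU1; case: (_ \notin _).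
by rewrite -mulr_suml ler_wpM2r // sum_weight_setU1 // ltnW.
Qed.

Variables (C : finType) (phi : TE * TD * TD -> C).
Hypothesis phi_inj : injective phi.
Variables (p rho lam x0 e0 : R).
Hypotheses (p01 : 0 <= p <= 1) (rho0 : 0 <= rho) (rhop : rho <= p)
  (rhox : p - rho <= x0) (lam1 : 1 <= lam) (px : p <= lam ^+ 2 * x0).
Hypotheses (e00 : 0 <= e0) (e0E : e0 ^+ 2 = #|TE|%:R^-1) (e01 : e0 <= 1)
  (D0 : (0 < #|TD|)%N) (x0E : x0 = #|TD|%:R^-1 * e0).

Definition centered (S : {set C}) (t : TE * TD * TD) : R := (phi t \in S)%:R - rho.

(* [Va], [Vb], [Vi] are the vertices and indices met by the triples in [acc].
   A new vertex or two uses of a new index bring in new triples, whence the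
   two inequalities. *)
Record walk_inv (acc : seq (TE * TD * TD)) (Va Vb : {set TD}) (Vi : {set TE}) : Prop := {
  inv_mem : forall t, t \in acc -> [/\ t.1.1 \in Vi, t.1.2 \in Va & t.2 \in Vb];
  inv_vertices : (#|Va| + #|Vb| <= #|[set t in acc]| + 2)%N;
  inv_indices : (2 * #|Vi| <= #|[set t in acc]|)%N }.

Lemma card_set_cons (K : finType) (t : K) acc :
  #|[set u in t :: acc]| = ((t \notin acc) + #|[set u in acc]|)%N.
Proof. by rewrite set_cons cardsU1 inE. Qed.

Lemma cardsU1U1 (K : finType) (a b : K) (V : {set K}) l :
  (#|a |: (b |: V)| + 2 * l <= #|V| + 2 * l.+1)%N.
Proof.
rewrite mulnS addnA leq_add2r addnC !cardsU1 addnA leq_add2r.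
by apply: (@leq_add _ _ 1 1); apply: leq_b1.
Qed.

(** The triples are adjoined one at a time. New vertices z.2, z.1, w.2, w.1 are charged, in this
    order, to the four triples that first contain them. The two triples of a new index are both new,
    and [distinct_pairs] makes them different. *)
Lemma walk_inv_step acc (Va Vb : {set TD}) (Vi : {set TE}) x z w (i i' : TE) : x.1 \in Va -> x.2 \in Va ->
  distinct_pairs x z -> distinct_pairs w z -> walk_inv acc Va Vb Vi ->
  walk_inv ((i', w.1, z.1) :: (i', w.2, z.2) :: (i, x.1, z.1) :: (i, x.2, z.2) :: acc)
    (w.1 |: (w.2 |: Va)) (z.1 |: (z.2 |: Vb)) (i' |: (i |: Vi)).
Proof.
move: x z w => [x1 x2] [z1 z2] [w1 w2] /= x1V x2V dxz dwz [hm hv hi].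
split.
- move=> t; rewrite !inE => /or4P[/eqP->|/eqP->|/eqP->|/orP[/eqP->|/hm[h1 h2 h3]]] /=.
  + by split; rewrite eqxx ?orbT.
  + by split; rewrite eqxx ?orbT.
  + by split; rewrite ?x1V ?eqxx ?orbT.
  + by split; rewrite ?x2V ?eqxx ?orbT.
  + by split; rewrite ?h1 ?h2 ?h3 ?orbT.
- have n1 : ((z2 \notin Vb) <= ((i, x2, z2) \notin acc))%N.
    by case: (boolP (_ \in acc)) => [/hm[_ _ /= ->]|_] //; case: (_ \notin _).
  have n2 : ((z1 \notin z2 |: Vb) <= ((i, x1, z1) \notin (i, x2, z2) :: acc))%N.
    rewrite !inE; case: eqP => [->|zz] /=; first by [].
    case: (boolP ((i, x1, z1) \in acc)) => [/hm[_ _ /= ->]|_] /=; first by [].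
    by rewrite !xpair_eqE; case: (z1 =P z2) zz => // _ _; rewrite !andbF; case: (_ \notin _).
  have hm2 t : t \in (i, x1, z1) :: (i, x2, z2) :: acc -> t.1.2 \in Va.
    by rewrite !inE => /or3P[/eqP->|/eqP->|/hm[_ ->]].
  have n3 : ((w2 \notin Va) <= ((i', w2, z2) \notin (i, x1, z1) :: (i, x2, z2) :: acc))%N.
    case: (boolP ((i', w2, z2) \in _)) => [h|_]; last by case: (_ \notin _).
    by have := hm2 _ h; rewrite /= => ->.
  have n4 : ((w1 \notin w2 |: Va) <=
      ((i', w1, z1) \notin (i', w2, z2) :: (i, x1, z1) :: (i, x2, z2) :: acc))%N.
    rewrite in_cons in_setU1; case: (w1 =P w2) => [->|ww] //=.
    rewrite !xpair_eqE; have -> : (w1 == w2) = false by apply/eqP.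
    rewrite andbF /=.
    case: (boolP ((i', w1, z1) \in _ :: _)) => [h|_]; last by case: (_ \notin _).
    by have := hm2 _ h; rewrite /= => ->.
  rewrite !card_set_cons !(cardsU1 w1) !(cardsU1 w2) !(cardsU1 z1) !(cardsU1 z2).
  move: n1 n2 n3 n4 hv; do 8!move: (nat_of_bool _) => ?.
  by move: #|_| #|_| #|_| => a b c; clear; lia.
- have pair_new (j : TE) (a a' b b' : TD) acc' (V : {set TE}) :
    ~~ ((a == a') && (b == b')) -> (forall t, t \in acc' -> t.1.1 \in V) ->
    (2 * #|V| <= #|[set t in acc']|)%N ->
    (2 * #|j |: V| <= #|[set t in (j, a, b) :: (j, a', b') :: acc']|)%N.
    move=> dab hV h; rewrite !card_set_cons cardsU1.
    case: (boolP (j \in V)) => [jV|jV] /=; first by apply: leq_trans h _; rewrite addnA leq_addl.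
    have -> : (j, a', b') \notin acc' by apply: contra jV => /hV.
    have -> : (j, a, b) \notin (j, a', b') :: acc'.
      rewrite in_cons !xpair_eqE eqxx /= negb_or dab /=.
      by apply: contra jV => /hV.
    by rewrite /= addnA mulnDr leq_add2l.
  apply: (pair_new) => //; last by apply: (pair_new) => // t /hm[].
  by move=> t; rewrite !inE => /or3P[/eqP->|/eqP->|/hm[->]] /=; rewrite ?eqxx ?orbT.
Qed.

(** Induction on the remaining length, [acc] being the entries already multiplied. A step uses four
    entries, hence lam^4, and chooses six elements z.1, z.2, w.1, w.2, i, i', each of which costs a
    factor r by [sum_weight_setU1]. At the end of the walk the expectation of the product is bounded
    by the weights. *)
Lemma expect_walk l : forall acc x y (Va Vb : {set TD}) (Vi : {set TE}) r,
  x.1 \in Va -> x.2 \in Va -> walk_inv acc Va Vb Vi ->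
  (#|Va| + 2 * l <= r)%N -> (#|Vb| + 2 * l <= r)%N -> (#|Vi| + 2 * l <= r)%N ->
  `|expect p (fun S => (\prod_(t <- acc) centered S t) * gram_pow (centered S) l x y)| <=
  lam ^+ (size acc + 4 * l) * #|TD|%:R ^+ 2 *
   (weight Va * weight Vb * weight Vi) * r%:R ^+ (6 * l).
Proof.
have lam0 : 0 <= lam by apply: le_trans lam1.
elim: l => [|l IH] acc x y Va Vb Vi r xa1 xa2 inv ra rb ri.
  rewrite muln0 addn0 mulr1 /=.
  apply: (@le_trans _ _ (lam ^+ size acc * x0 ^+ #|[set t in acc]|)).
    rewrite (@eq_expect _ _ _ _ (fun S => (x == y)%:R * \prod_(z <- map phi acc) ((z \in S)%:R - rho))).
      rewrite expectZ normrM.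
      have := expect_centered_prod p01 rho0 rhop rhox lam1 px (map phi acc).
      rewrite size_map.
      have -> : #|[set z in map phi acc]| = #|[set t in acc]|.
        rewrite -(card_imset _ phi_inj); apply: eq_card => z.
        rewrite inE; apply/mapP/imsetP => [[t ta ->]|[t]].
          by exists t; rewrite ?inE.
        by rewrite inE => ta ->; exists t.
      by case: (x == y); rewrite ?normr1 ?mul1r // normr0 mul0r => /(le_trans (normr_ge0 _)).
    by move=> S; rewrite mulrC big_map.
  rewrite -mulrA ler_wpM2l ?exprn_ge0 //.
  case: inv => _ hv hi; set v := #|[set t in acc]| in hv hi *.
  have DR : (0 : R) < #|TD|%:R by rewrite ltr0n.
  have D1 : (1 : R) <= #|TD|%:R by rewrite ler1n.
  have Di1 : (#|TD|%:R : R)^-1 <= 1 by rewrite invf_le1.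
  have Di0 : 0 <= (#|TD|%:R : R)^-1 by rewrite invr_ge0 ltW.
  (* With v distinct triples, D^-v pays for all vertices up to a factor D^2, and e0^v pays for the
     indices since e0^2 = 1/E. *)
  rewrite x0E exprMn mulrA; apply: ler_pM; rewrite ?exprn_ge0 //.
    rewrite /weight -exprD.
    apply: (@le_trans _ _ (#|TD|%:R ^+ 2 * (#|TD|%:R^-1 ^+ (v + 2)))).
      by rewrite exprD mulrCA -exprMn divff ?lt0r_neq0 // expr1n mulr1.
    by rewrite ler_wpM2l ?exprn_ge0 ?(ltW DR) // ler_wiXn2l.
  by rewrite /weight -e0E -exprM ler_wiXn2l.
(* One more level multiplies by two matrix entries, each a sum over an index of products of two
   tensor entries. *)
pose nxt z w i i' := (i', w.1, z.1) :: (i', w.2, z.2) :: (i, x.1, z.1) :: (i, x.2, z.2) :: acc.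
pose G z w i i' := expect p (fun S => (\prod_(t <- nxt z w i i') centered S t) * gram_pow (centered S) l w y).
have -> : expect p (fun S => (\prod_(t <- acc) centered S t) * gram_pow (centered S) l.+1 x y) =
   \sum_z \sum_w \sum_i \sum_i' (distinct_pairs x z && distinct_pairs w z)%:R * G z w i i'.
  rewrite (@eq_expect _ _ _ _ (fun S => \sum_z \sum_w \sum_i \sum_i'
     (distinct_pairs x z && distinct_pairs w z)%:R *
     ((\prod_(t <- nxt z w i i') centered S t) * gram_pow (centered S) l w y))).
    rewrite expect_sum; apply: eq_bigr => z _; rewrite expect_sum; apply: eq_bigr => w _.
    rewrite expect_sum; apply: eq_bigr => i _; rewrite expect_sum; apply: eq_bigr => i' _.
    by rewrite expectZ.
  move=> S /=; rewrite mulr_sumr; apply: eq_bigr => z _; rewrite mulr_sumr; apply: eq_bigr => w _.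
  rewrite /pairmx -mulnb natrM !mulrA.
  set A := \prod_(t <- acc) _; set K := gram_pow _ _ _ _.
  set n1 := (distinct_pairs x z)%:R; set n2 := (distinct_pairs w z)%:R.
  rewrite -!mulrA.
  rewrite (_ : A * (n1 * ((\sum_i _) * (n2 * ((\sum_i _) * K)))) = n1 * n2 * A * K *
     (\sum_i centered S (i, x.1, z.1) * centered S (i, x.2, z.2)) *
     (\sum_i' centered S (i', w.1, z.1) * centered S (i', w.2, z.2))); last by ring.
  rewrite [X in X * _]mulr_sumr mulr_suml; apply: eq_bigr => i _.
  rewrite mulr_sumr; apply: eq_bigr => i' _.
  by rewrite !big_cons -/A; ring.
pose c := lam ^+ (size acc + 4 * l.+1) * #|TD|%:R ^+ 2 * r%:R ^+ (6 * l).
have c0 : 0 <= c by rewrite /c !mulr_ge0 ?exprn_ge0.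
have Gb z w i i' : `|(distinct_pairs x z && distinct_pairs w z)%:R * G z w i i'| <=
   c * (weight (w.1 |: (w.2 |: Va)) * weight (z.1 |: (z.2 |: Vb)) * weight (i' |: (i |: Vi))).
  case: (boolP (_ && _)) => [/andP[d1 d2]|_]; last first.
    by rewrite mul0r normr0 mulr_ge0 // mulr_ge0 ?weight_set_ge0 // mulr_ge0 ?weight_set_ge0.
  rewrite mul1r /G; apply: le_trans (IH _ _ _ _ _ _ r _ _ (walk_inv_step i i' xa1 xa2 d1 d2 inv) _ _ _) _.
  - by rewrite !inE eqxx.
  - by rewrite !inE eqxx orbT.
  - exact: leq_trans (cardsU1U1 _ _ _ _) ra.
  - exact: leq_trans (cardsU1U1 _ _ _ _) rb.
  - exact: leq_trans (cardsU1U1 _ _ _ _) ri.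
  rewrite /c /= (_ : (size acc).+4 + 4 * l = size acc + 4 * l.+1)%N; last by rewrite mulnS addnA addn4.
  by rewrite le_eqVlt; apply/orP; left; apply/eqP; ring.
apply: (@le_trans _ _ (\sum_z \sum_w \sum_i \sum_i'
  c * (weight (w.1 |: (w.2 |: Va)) * weight (z.1 |: (z.2 |: Vb)) * weight (i' |: (i |: Vi))))).
  apply: le_trans (ler_norm_sum _ _ _) _; apply: ler_sum => z _.
  apply: le_trans (ler_norm_sum _ _ _) _; apply: ler_sum => w _.
  apply: le_trans (ler_norm_sum _ _ _) _; apply: ler_sum => i _.
  apply: le_trans (ler_norm_sum _ _ _) _; apply: ler_sum => i' _.
  exact: Gb.
(* The three weights depend on w, on z and on (i, i') separately, so the sum factors. *)
have -> : \sum_z \sum_w \sum_i \sum_i'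
  c * (weight (w.1 |: (w.2 |: Va)) * weight (z.1 |: (z.2 |: Vb)) * weight (i' |: (i |: Vi))) =
  c * ((\sum_(w : TD * TD) weight (w.1 |: (w.2 |: Va))) * (\sum_(z : TD * TD) weight (z.1 |: (z.2 |: Vb))) *
     (\sum_i \sum_i' weight (i' |: (i |: Vi)))).
  rewrite exchange_big /= !mulr_suml mulr_sumr; apply: eq_bigr => w _.
  rewrite [X in _ * (X * _)]mulr_sumr mulr_suml mulr_sumr; apply: eq_bigr => z _.
  rewrite !mulr_sumr; apply: eq_bigr => i _.
  by rewrite !mulr_sumr.
have smallV (K : finType) (V : {set K}) : (#|V| + 2 * l.+1 <= r)%N -> (#|V|.+1 < r)%N.
  by move=> h; apply: leq_trans h; rewrite mulnS addnA addn2 leq_addr.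
have pairE (K : finType) (V : {set K}) : (#|V|.+1 < r)%N ->
   \sum_(w : K * K) weight (w.1 |: (w.2 |: V)) <= weight V * r%:R ^+ 2.
  move=> Vr; rewrite -(pair_bigA _ (fun a b => weight (a |: (b |: V)))) /=.
  exact: sum_weight_setU2.
apply: (@le_trans _ _ (c * ((weight Va * r%:R ^+ 2) * (weight Vb * r%:R ^+ 2) * (weight Vi * r%:R ^+ 2)))).
  apply: ler_wpM2l => //; apply: ler_pM.
  - by rewrite mulr_ge0 // sumr_ge0 // => *; rewrite weight_set_ge0.
  - by rewrite sumr_ge0 // => *; rewrite sumr_ge0 // => *; rewrite weight_set_ge0.
  - apply: ler_pM; rewrite ?pairE ?(smallV _ _ ra) ?(smallV _ _ rb) //.
    + by rewrite sumr_ge0 // => *; rewrite weight_set_ge0.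
    + by rewrite sumr_ge0 // => *; rewrite weight_set_ge0.
  - by rewrite exchange_big /=; apply: sum_weight_setU2; exact: smallV ri.
have -> : (r%:R : R) ^+ (6 * l.+1) = r%:R ^+ 6 * r%:R ^+ (6 * l) by rewrite mulnS exprD.
rewrite /c; move: (lam ^+ _) (r%:R ^+ (6 * l)) => L M.
by rewrite le_eqVlt; apply/orP; left; apply/eqP; ring.
Qed.

(** The starting pair of the closed walk brings the two further factors r, and r = 2 l + 2 bounds
    the number of distinct vertices of each kind. *)
Lemma expect_trace l :
  expect p (fun S => \sum_x gram_pow (centered S) l x x) <=
  lam ^+ (4 * l) * #|TD|%:R ^+ 2 * (2 * l + 2)%:R ^+ (6 * l + 2).
Proof.
have lam0 : 0 <= lam by apply: le_trans lam1.
pose r := (2 * l + 2)%N.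
rewrite expect_sum.
apply: (@le_trans _ _ (\sum_(x : TD * TD) lam ^+ (4 * l) * #|TD|%:R ^+ 2 * r%:R ^+ (6 * l) *
    weight (x.1 |: (x.2 |: finset.set0)))).
  apply: ler_sum => x _; apply: le_trans (ler_norm _) _.
  have inv : walk_inv [::] (x.1 |: (x.2 |: finset.set0)) finset.set0 finset.set0.
    split=> //; last by rewrite cards0.
    (* No triple has been met yet: the starting vertices account for the + 2 in [inv_vertices]. *)
    by rewrite !cardsU1 !cards0; do !case: (_ \notin _).
  have := @expect_walk l [::] x x _ _ _ r _ _ inv.
  rewrite (@eq_expect _ _ _ _ (fun S => gram_pow (centered S) l x x)); last first.
    by move=> S; rewrite big_nil mul1r.
  rewrite !inE !eqxx orbT => h; apply: le_trans (h _ _ _ _ _) _ => //.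
  - by apply: leq_trans (cardsU1U1 _ _ _ _) _; rewrite cards0 add0n mulnS addnC.
  - by rewrite cards0 /r; clear; lia.
  - by rewrite cards0 /r; clear; lia.
  rewrite /weight !cards0 !expr0 !mulr1 add0n le_eqVlt; apply/orP; left; apply/eqP; ring.
rewrite -mulr_sumr -[X in _ <= X]mulr1 exprD !mulrA.
rewrite -!mulrA !ler_wpM2l ?exprn_ge0 // mulr1.
rewrite -(pair_bigA _ (fun a b => weight (a |: (b |: finset.set0)))) /=.
apply: le_trans (sum_weight_setU2 (r := r) _) _; first by rewrite cards0 /r; clear; lia.
by rewrite /weight cards0 mul1r.
Qed.

End Walks.

(** * Certificates for multilinear forms *)

Section Certificate.
Variable R : realType.

(** By Lagrange's identity, twice the difference of the two sides is the sum of (f_i g_j - f_j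
    g_i)^2. *)
Lemma sum_Cauchy_Schwarz (I : finType) (f g : I -> R) :
  (\sum_i f i * g i) ^+ 2 <= (\sum_i f i ^+ 2) * (\sum_i g i ^+ 2).
Proof.
have lagrange : 0 <= \sum_i \sum_j (f i * g j - f j * g i) ^+ 2.
  by apply: sumr_ge0 => i _; apply: sumr_ge0 => j _; exact: sqr_ge0.
have e : \sum_i \sum_j (f i * g j - f j * g i) ^+ 2 =
   2 * ((\sum_i f i ^+ 2) * (\sum_i g i ^+ 2) - (\sum_i f i * g i) ^+ 2).
  transitivity (\sum_i \sum_j (f i ^+ 2 * g j ^+ 2 + f j ^+ 2 * g i ^+ 2
      + (- 2) * ((f i * g i) * (f j * g j)))).
    by apply: eq_bigr => i _; apply: eq_bigr => j _; ring.
  under eq_bigr do rewrite !big_split /=.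
  rewrite !big_split /=.
  have h1 : \sum_i \sum_j f i ^+ 2 * g j ^+ 2 = (\sum_i f i ^+ 2) * (\sum_i g i ^+ 2).
    by rewrite mulr_suml; apply: eq_bigr => i _; rewrite mulr_sumr.
  have h2 : \sum_i \sum_j f j ^+ 2 * g i ^+ 2 = (\sum_i f i ^+ 2) * (\sum_i g i ^+ 2).
    by rewrite exchange_big /=; exact: h1.
  have h3 : \sum_i \sum_j (- 2) * (f i * g i * (f j * g j)) = (- 2) * (\sum_i f i * g i) ^+ 2.
    rewrite expr2 mulr_suml mulr_sumr; apply: eq_bigr => i _.
    by rewrite !mulr_sumr.
  by rewrite h1 h2 h3; ring.
by move: lagrange; rewrite e pmulr_rge0 ?ltr0n // subr_ge0.
Qed.

Lemma sum_pair (I J : finType) (F : I * J -> R) :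
  \sum_x F x = \sum_i \sum_j F (i, j).
Proof. by rewrite pair_bigA; apply: eq_bigr => -[]. Qed.

(** * Bilinear forms and iterated Gram matrices *)

Section Gram.
Variable X : finType.
Implicit Types (M : X -> X -> R) (U V : X -> R).

Definition gram M x y := \sum_z M x z * M y z.

Fixpoint gram_iter M t : X -> X -> R :=
  if t is t'.+1 then gram (gram_iter M t') else M.

Definition frobenius2 M := \sum_x \sum_y M x y ^+ 2.

Definition bilin M U V := \sum_x \sum_y U x * M x y * V y.

Lemma frobenius2_gram M : frobenius2 M = \sum_x gram M x x.
Proof. by []. Qed.

Lemma gram_iterSr M t : gram_iter M t.+1 = gram_iter (gram M) t.
Proof. by elim: t => //= t ->. Qed.

(** Cauchy-Schwarz against V leaves the squared norm of M^T U, which is U^T (M M^T) U. *)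
Lemma bilin_sqr_gram M U V B : \sum_y V y ^+ 2 <= B ->
  bilin M U V ^+ 2 <= B * bilin (gram M) U U.
Proof.
move=> VB; have -> : bilin M U V = \sum_y (\sum_x U x * M x y) * V y.
  by rewrite /bilin exchange_big /=; apply: eq_bigr => y _; rewrite mulr_suml.
have -> : bilin (gram M) U U = \sum_y (\sum_x U x * M x y) ^+ 2.
  rewrite /bilin /gram.
  transitivity (\sum_x \sum_x' \sum_y (U x * M x y) * (U x' * M x' y)).
    apply: eq_bigr => x _; apply: eq_bigr => x' _.
    by rewrite mulr_sumr mulr_suml; apply: eq_bigr => z _; ring.
  under eq_bigr do rewrite exchange_big /=.
  rewrite exchange_big /=; apply: eq_bigr => y _.
  by rewrite expr2 mulr_suml; apply: eq_bigr => x _; rewrite mulr_sumr.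
apply: le_trans (sum_Cauchy_Schwarz _ _) _; rewrite mulrC.
by apply: ler_wpM2r => //; apply: sumr_ge0 => y _; exact: sqr_ge0.
Qed.

Lemma bilin_sqr_frobenius M U V B : \sum_x U x ^+ 2 <= B -> \sum_y V y ^+ 2 <= B ->
  bilin M U V ^+ 2 <= B ^+ 2 * frobenius2 M.
Proof.
move=> UB VB.
have U0 : 0 <= \sum_x U x ^+ 2 by apply: sumr_ge0 => x _; exact: sqr_ge0.
have V0 : 0 <= \sum_x V x ^+ 2 by apply: sumr_ge0 => x _; exact: sqr_ge0.
have -> : bilin M U V = \sum_(w : X * X) (U w.1 * V w.2) * M w.1 w.2.
  rewrite -(pair_bigA _ (fun x y => U x * V y * M x y)) /=.
  by apply: eq_bigr => x _; apply: eq_bigr => y _; ring.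
apply: le_trans (sum_Cauchy_Schwarz _ _) _.
rewrite -(pair_bigA _ (fun x y => (U x * V y) ^+ 2)) -(pair_bigA _ (fun x y => M x y ^+ 2)) /=.
apply: ler_wpM2r.
  by apply: sumr_ge0 => x _; apply: sumr_ge0 => y _; exact: sqr_ge0.
have -> : \sum_x \sum_y (U x * V y) ^+ 2 = (\sum_x U x ^+ 2) * (\sum_y V y ^+ 2).
  rewrite mulr_suml; apply: eq_bigr => x _; rewrite mulr_sumr.
  by apply: eq_bigr => y _; rewrite exprMn.
by rewrite expr2; apply: ler_pM.
Qed.

(** Each use of [bilin_sqr_gram] doubles the exponent, replaces M by M M^T and V by U; the Frobenius
    norm ends the chain. This is why M and V vary in the induction. *)
Lemma bilin_gram_iter s : forall M U V B,
  \sum_x U x ^+ 2 <= B -> \sum_y V y ^+ 2 <= B ->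
  bilin M U V ^+ (2 * 2 ^ s) <= B ^+ (2 * 2 ^ s) * frobenius2 (gram_iter M s).
Proof.
elim: s => [|s IH] M U V B UB VB; first by rewrite muln1; exact: bilin_sqr_frobenius.
have B0 : 0 <= B by apply: le_trans UB; apply: sumr_ge0 => x _; exact: sqr_ge0.
have e : (2 * 2 ^ s.+1 = 2 * (2 * 2 ^ s))%N by rewrite expnS.
rewrite gram_iterSr e exprM.
apply: (@le_trans _ _ ((B * bilin (gram M) U U) ^+ (2 * 2 ^ s))).
  apply: lerXn2r; rewrite ?nnegrE ?sqr_ge0 //.
    by apply: le_trans (sqr_ge0 _) (bilin_sqr_gram M U VB).
  exact: bilin_sqr_gram.
have eB N : B ^+ (2 * N) = B ^+ N * B ^+ N by rewrite mul2n -addnn exprD.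
rewrite exprMn eB -mulrA ler_wpM2l ?exprn_ge0 //.
exact: IH.
Qed.

Lemma gram_iterZ c M t x y : gram_iter (fun x y => c * M x y) t x y =
  c ^+ (2 ^ t) * gram_iter M t x y.
Proof.
elim: t x y => [|t IH] x y; first by rewrite expn0 expr1.
rewrite /= /gram mulr_sumr; apply: eq_bigr => z _.
by rewrite !IH expnS mulnC exprM expr2; ring.
Qed.

Lemma frobenius2_gram_iterZ c M t : frobenius2 (gram_iter (fun x y => c * M x y) t) =
  c ^+ (2 * 2 ^ t) * frobenius2 (gram_iter M t).
Proof.
rewrite /frobenius2 mulr_sumr; apply: eq_bigr => x _; rewrite mulr_sumr.
by apply: eq_bigr => y _; rewrite gram_iterZ exprMn -exprM mulnC.
Qed.

End Gram.

(** * The pair matrix of a tensor and its trilinear form *)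

Section Tensor.
Variables (TE TD : finType).
Implicit Types T : TE * TD * TD -> R.

Lemma gram_powS T l x y : gram_pow T l.+1 x y =
  \sum_w gram (pairmx T) x w * gram_pow T l w y.
Proof.
rewrite /= exchange_big /=; apply: eq_bigr => w _.
by rewrite /gram mulr_suml.
Qed.

Lemma gram_powD T a b x y : gram_pow T (a + b) x y =
  \sum_w gram_pow T a x w * gram_pow T b w y.
Proof.
elim: a x => [|a IH] x.
  rewrite add0n (bigD1 x) //= eqxx mul1r big1 ?addr0 // => w wx.
  by rewrite eq_sym (negPf wx) mul0r.
rewrite addSn gram_powS.
under [RHS]eq_bigr do rewrite gram_powS mulr_suml.
rewrite exchange_big /=; apply: eq_bigr => w _.
by rewrite IH mulr_sumr; apply: eq_bigr => w' _; rewrite mulrA.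
Qed.

Lemma gram_pow1 T x y : gram_pow T 1 x y = gram (pairmx T) x y.
Proof.
rewrite gram_powS (bigD1 y) //= eqxx mulr1 big1 ?addr0 // => w wy.
by rewrite (negPf wy) mulr0.
Qed.

Lemma gram_pow_sym T l x y : gram_pow T l x y = gram_pow T l y x.
Proof.
elim: l x y => [|l IH] x y; first by rewrite /= eq_sym.
rewrite gram_powS -addn1 gram_powD; apply: eq_bigr => w _.
rewrite gram_pow1 mulrC IH; congr (_ * _).
by apply: eq_bigr => z _; rewrite mulrC.
Qed.

(** From level 1 on the matrices are symmetric, so multiplying by the transpose is squaring. *)
Lemma gram_iter_pow T t x y :
  gram_iter (pairmx T) t.+1 x y = gram_pow T (2 ^ t) x y.
Proof.
elim: t x y => [|t IH] x y; first by rewrite gram_pow1.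
rewrite [LHS]/= -/(gram_iter _ t.+1) /gram expnS mul2n -addnn gram_powD.
by apply: eq_bigr => z _; rewrite !IH (gram_pow_sym _ _ y).
Qed.

(** The squared Frobenius norm of M_t is the trace of M_(t+1), which is a power of M M^T. *)
Lemma frobenius2_trace T t :
  frobenius2 (gram_iter (pairmx T) t) = \sum_x gram_pow T (2 ^ t) x x.
Proof.
by rewrite frobenius2_gram; apply: eq_bigr => x _; rewrite -gram_iter_pow.
Qed.

Lemma pairmxZ c T x y : pairmx (fun t => c * T t) x y = c ^+ 2 * pairmx T x y.
Proof.
rewrite /pairmx [RHS]mulrCA; congr (_ * _); rewrite mulr_sumr; apply: eq_bigr => i _; ring.
Qed.

(* The terms with (a,b) = (a',b') of the square are bounded by the sum of the
   squares of the entries, the others form a bilinear form of [pairmx T]. *)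
Lemma trilinear_sqr T (y : TE -> bool) (u v : TD -> bool) :
  (\sum_i \sum_a \sum_b T (i, a, b) * (y i && u a && v b)%:R) ^+ 2 <=
  #|TE|%:R * (bilin (pairmx T) (fun x => (u x.1 && u x.2)%:R) (fun x => (v x.1 && v x.2)%:R)
     + \sum_i \sum_a \sum_b T (i, a, b) ^+ 2).
Proof.
pose c i := \sum_a \sum_b T (i, a, b) * (u a && v b)%:R.
have -> : \sum_i \sum_a \sum_b T (i, a, b) * (y i && u a && v b)%:R = \sum_i (y i)%:R * c i.
  apply: eq_bigr => i _; rewrite /c mulr_sumr; apply: eq_bigr => a _.
  rewrite mulr_sumr; apply: eq_bigr => b _.
  by rewrite -andbA -mulnb natrM; ring.
apply: le_trans (sum_Cauchy_Schwarz _ _) _.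
have c0 : 0 <= \sum_i c i ^+ 2 by apply: sumr_ge0 => i _; exact: sqr_ge0.
apply: ler_pM => //.
- by apply: sumr_ge0 => i _; exact: sqr_ge0.
- rewrite -sum1_card natr_sum; apply: ler_sum => i _.
  by case: (y i); rewrite ?expr1n ?expr0n /= ?ler01.
have -> : \sum_i c i ^+ 2 = \sum_(x : TD * TD) \sum_(z : TD * TD)
    (u x.1 && u x.2)%:R * (v z.1 && v z.2)%:R * \sum_i T (i, x.1, z.1) * T (i, x.2, z.2).
  transitivity (\sum_i \sum_(x : TD * TD) \sum_(z : TD * TD)
    (u x.1 && u x.2)%:R * (v z.1 && v z.2)%:R * (T (i, x.1, z.1) * T (i, x.2, z.2))).
    apply: eq_bigr => i _.
    rewrite expr2 /c mulr_suml -(pair_bigA _ (fun a a' => \sum_(z : TD * TD)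
      (u a && u a')%:R * (v z.1 && v z.2)%:R * (T (i, a, z.1) * T (i, a', z.2)))) /=.
    apply: eq_bigr => a _; rewrite mulr_sumr; apply: eq_bigr => a' _.
    rewrite mulr_suml -(pair_bigA _ (fun b b' => 
      (u a && u a')%:R * (v b && v b')%:R * (T (i, a, b) * T (i, a', b')))) /=.
    apply: eq_bigr => b _; rewrite mulr_sumr; apply: eq_bigr => b' _.
    by rewrite -!mulnb !natrM; ring.
  rewrite exchange_big /=; apply: eq_bigr => x _.
  rewrite exchange_big /=; apply: eq_bigr => z _.
  by rewrite mulr_sumr.
have split_pair x z : (u x.1 && u x.2)%:R * (v z.1 && v z.2)%:R * (\sum_i T (i, x.1, z.1) * T (i, x.2, z.2)) =
   (u x.1 && u x.2)%:R * pairmx T x z * (v z.1 && v z.2)%:R +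
   (~~ distinct_pairs x z)%:R * ((u x.1 && u x.2)%:R * (v z.1 && v z.2)%:R) * (\sum_i T (i, x.1, z.1) * T (i, x.2, z.2)).
  rewrite /pairmx; case: (distinct_pairs x z) => /=; ring.
under eq_bigr do under eq_bigr do rewrite split_pair.
under eq_bigr do rewrite big_split /=.
rewrite big_split /= /bilin lerD2l.
apply: (@le_trans _ _ (\sum_(x : TD * TD) \sum_(z : TD * TD) (~~ distinct_pairs x z)%:R * \sum_i T (i, x.1, z.1) ^+ 2)).
  apply: ler_sum => x _; apply: ler_sum => z _.
  rewrite /distinct_pairs negbK; case: eqP => [e1|_] /=; last by rewrite !mul0r.
  case: eqP => [e2|_] /=; last by rewrite !mul0r.
  rewrite -e1 -e2 !mul1r !andbb.
  have S0 : 0 <= \sum_i T (i, x.1, z.1) ^+ 2 by apply: sumr_ge0 => i _; exact: sqr_ge0.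
  rewrite (eq_bigr (fun i => T (i, x.1, z.1) ^+ 2)); last by move=> i _; rewrite expr2.
  by case: (u _); case: (v _); rewrite ?mul1r ?mul0r.
rewrite -(pair_bigA _ (fun a a' => \sum_(z : TD * TD)
   (~~ distinct_pairs (a, a') z)%:R * \sum_i T (i, a, z.1) ^+ 2)) /=.
rewrite [leRHS]exchange_big /= le_eqVlt; apply/orP; left; apply/eqP; apply: eq_bigr => a _.
rewrite (bigD1 a) //= [X in _ + X]big1 ?addr0 => [|a' a'a]; last first.
  by rewrite big1 // => z _; rewrite /distinct_pairs /= eq_sym (negPf a'a) /= mul0r.
rewrite -(pair_bigA _ (fun b b' => (~~ distinct_pairs (a, a) (b, b'))%:R * \sum_i T (i, a, b) ^+ 2)) /=.
rewrite [RHS]exchange_big /=; apply: eq_bigr => b _.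
rewrite (bigD1 b) //= [X in _ + X]big1 ?addr0 => [|b' b'b]; last first.
  by rewrite /distinct_pairs /= eqxx eq_sym (negPf b'b) /= mul0r.
by rewrite /distinct_pairs /= !eqxx /= mul1r.
Qed.

End Tensor.

(** * The integer tests as inequalities between real numbers *)

Section Link.
Variables (A : nat -> nat) (g E D Q j : nat).

Definition scaled_tensor (t : 'I_E * 'I_D * 'I_D) : R :=
  (Q * A (t.2 + D * (t.1.2 + D * t.1.1)))%:R - j%:R.

Definition scaled_pairmx (x z : 'I_D * 'I_D) : R :=
  (2 * g * g * Q)%:R * pairmx scaled_tensor x z.

(** The product (P - M)(P' - M') is P P' + M M' less P M' + M P', and the sign (sg + u) mod 2
    collects exactly these terms. *)
Lemma walkmxE t (a a' b b' : 'I_D) :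
  (walkmx A g E D Q j t 0 a a' b b')%:R - (walkmx A g E D Q j t 1 a a' b b')%:R =
  gram_iter scaled_pairmx t (a, a') (b, b').
Proof.
elim: t a a' b b' => [|t IH] a a' b b'.
  rewrite /= /scaled_pairmx /pairmx /= !natr_sum -sumrB mulrA mulr_sumr.
  apply: eq_bigr => i _; rewrite /scaled_tensor /= /distinct_pairs /=.
  rewrite (_ : (1 - (a == a' :> nat) * (b == b' :> nat))%N =
               ~~ ((a == a') && (b == b')) :> nat); last first.
    by rewrite !val_eqE; case: (a == a'); case: (b == b').
  move: (A _) (A _) (~~ _) => m n c.
  rewrite !mul1n !mul0n ?addn0 ?add0n ?subn0 !natrM !natrD !natrM; ring.
rewrite /= !big_ord_recl !big_ord0 /= !addn0 !natrD.
rewrite /gram sum_pair.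
rewrite !natr_sum -!big_split -sumrB /=; apply: eq_bigr => e _.
rewrite !natr_sum -!big_split -sumrB /=; apply: eq_bigr => e' _.
by rewrite -!IH !natrM; ring.
Qed.

Lemma frobenius_testE s : frobenius_test A g E D Q j s =
  (frobenius2 (gram_iter scaled_pairmx s) <= (Q * j)%:R ^+ (4 * 2 ^ s) :> R).
Proof.
have -> : frobenius2 (gram_iter scaled_pairmx s) =
  \sum_(a < D) \sum_(a' < D) \sum_(b < D) \sum_(b' < D)
     (gram_iter scaled_pairmx s (a, a') (b, b')) ^+ 2.
  rewrite /frobenius2 sum_pair; apply: eq_bigr => a _; apply: eq_bigr => a' _.
  by rewrite sum_pair.
rewrite /frobenius_test -(ler_nat R) natrD natrX -lerBlDr; congr (_ <= _).
rewrite !natr_sum -sumrB; apply: eq_bigr => a _.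
rewrite !natr_sum -sumrB; apply: eq_bigr => a' _.
rewrite !natr_sum -sumrB; apply: eq_bigr => b _.
rewrite !natr_sum -sumrB; apply: eq_bigr => b' _.
by rewrite -walkmxE !natrD !natrM; ring.
Qed.

Lemma sum_digits (M : nat) (F : nat -> R) :
  \sum_(z < D * M) F z = \sum_(y < M) \sum_(b < D) F (b + D * y)%N.
Proof.
elim: M => [|M IH]; first by rewrite muln0 !big_ord0.
rewrite big_ord_recr /= -IH mulnS addnC big_split_ord /=; congr (_ + _).
by apply: eq_bigr => b _; rewrite addnC.
Qed.

Lemma diagonal_testE : Q = (D * (D * E))%N -> diagonal_test A g E Q j =
  ((2 * g * g * E)%:R * (\sum_i \sum_a \sum_b scaled_tensor (i, a, b) ^+ 2) <= (Q * j)%:R ^+ 2 :> R).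
Proof.
move=> QE; have -> : \sum_i \sum_a \sum_b scaled_tensor (i, a, b) ^+ 2 =
    \sum_(z < Q) ((Q * A z)%:R - j%:R) ^+ 2.
  rewrite [in RHS]QE (sum_digits _ (fun z => ((D * (D * E) * A z)%:R - j%:R) ^+ 2)).
  rewrite (sum_digits _ (fun y => \sum_(b < D) ((D * (D * E) * A (b + D * y)%N)%:R - j%:R) ^+ 2)).
  by rewrite -QE.
rewrite /diagonal_test -(ler_nat R) natrD -lerBlDr; congr (_ <= _); last first.
  by rewrite expr2 -natrM.
rewrite !(natrM _ (2 * g * g * E)) -mulrBr; congr (_ * _).
rewrite !natr_sum -sumrB; apply: eq_bigr => z _.
by rewrite !natrD !natrM; ring.
Qed.

(** The Frobenius test bounds 2 g^2 Q times the bilinear form by D^2 (Q j)^2, as D^2 bounds the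
    squared norms of the 0/1 vectors U and V. Since Q = D^2 E, this bounds 2 g^2 E times the form by
    (Q j)^2. The diagonal test does the same for the squares of the entries, and the factors 2 leave
    room for both. *)
Lemma tests_trilinear_bound s (y : 'I_E -> bool) (u v : 'I_D -> bool) :
  Q = (D * (D * E))%N ->
  frobenius_test A g E D Q j s -> diagonal_test A g E Q j ->
  g%:R ^+ 2 * (\sum_i \sum_a \sum_b scaled_tensor (i, a, b) * (y i && u a && v b)%:R) ^+ 2
  <= (Q * j)%:R ^+ 2 :> R.
Proof.
move=> QE ft dt.
have [D0|D0] := posnP D.
  rewrite big1 ?expr0n ?mulr0 ?sqr_ge0 // => i _.
  rewrite big1 // => a _; suff : False by [].
  by move: (leq_ltn_trans (leq0n a) (ltn_ord a)); rewrite lt0n D0.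
set U := fun x : 'I_D * 'I_D => (u x.1 && u x.2)%:R : R.
set V := fun x : 'I_D * 'I_D => (v x.1 && v x.2)%:R : R.
set b := bilin (pairmx scaled_tensor) U V.
have norm1 (w : 'I_D -> bool) : \sum_(x : 'I_D * 'I_D) (w x.1 && w x.2)%:R ^+ 2 <= (D * D)%:R :> R.
  have -> : (D * D)%N = #|{: 'I_D * 'I_D}| by rewrite card_prod !card_ord.
  rewrite -sum1_card natr_sum; apply: ler_sum => x _.
  by case: (_ && _); rewrite ?expr1n ?expr0n /= ?ler01.
have DR : (0 : R) < (D * D)%:R by rewrite ltr0n muln_gt0 D0.
have hb : (2 * g * g * Q)%:R * b <= (D * D)%:R * (Q * j)%:R ^+ 2.
  have e : bilin scaled_pairmx U V = (2 * g * g * Q)%:R * b.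
    rewrite /b /bilin mulr_sumr; apply: eq_bigr => x _; rewrite mulr_sumr.
    by apply: eq_bigr => z _; rewrite /scaled_pairmx; ring.
  have := bilin_gram_iter s scaled_pairmx (norm1 u) (norm1 v).
  rewrite -/U -/V e => h; move: ft; rewrite frobenius_testE => ft.
  have h2 : ((2 * g * g * Q)%:R * b) ^+ (2 * 2 ^ s) <= ((D * D)%:R * (Q * j)%:R ^+ 2) ^+ (2 * 2 ^ s).
    apply: le_trans h _; rewrite exprMn ler_wpM2l ?exprn_ge0 //.
    by apply: le_trans ft _; rewrite -exprM mulnA.
  (* The exponent 2 * 2 ^ s is even, so the root is taken with the absolute value. *)
  apply: le_trans (ler_norm _) _.
  rewrite -(@ler_pXn2r _ (2 * 2 ^ s)) ?nnegrE ?mulr_ge0 ?exprn_ge0 ?muln_gt0 ?expn_gt0 //.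
  by rewrite exprM real_normK ?num_real // -exprM.
have h1 : (2 * g * g * E)%:R * b <= (Q * j)%:R ^+ 2.
  rewrite -(ler_pM2l DR); apply: le_trans hb.
  by rewrite QE !natrM le_eqVlt; apply/orP; left; apply/eqP; ring.
move: dt; rewrite diagonal_testE // => dt.
have h3 := trilinear_sqr scaled_tensor y u v.
rewrite card_ord -/U -/V -/b in h3.
apply: le_trans (_ : _ <= g%:R ^+ 2 * (E%:R * (b + \sum_i \sum_a \sum_b0 scaled_tensor (i, a, b0) ^+ 2))) _.
  by rewrite ler_wpM2l ?exprn_ge0.
rewrite -(@ler_pM2l _ 2) //.
apply: le_trans (_ : _ <= (2 * g * g * E)%:R * b + (2 * g * g * E)%:R * (\sum_i \sum_a \sum_b0 scaled_tensor (i, a, b0) ^+ 2)) _.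
  by rewrite !natrM le_eqVlt; apply/orP; left; apply/eqP; ring.
by rewrite [leRHS]mulr_natl mulr2n; apply: lerD.
Qed.

End Link.
End Certificate.

(** * Soundness *)

Section Blocks.
Variables q k n : nat.
Hypothesis q2 : (2 <= q)%N.
Local Notation N := (q * n)%N.
Local Notation D := (N ^ k./2)%N.
Local Notation E := (N ^ odd k)%N.
Local Notation Q := (N ^ k)%N.
Local Open Scope nat_scope.
Implicit Types (ct : constraint q k n) (s : seq 'I_k).

Lemma Zq_lt (c : 'Z_q) : c < q.
Proof. by rewrite -[q in _ < q](Zp_cast q2) ltn_ord. Qed.

Lemma digit_lt ct i : digit ct i < N.
Proof.
rewrite /digit; have h1 := ltn_ord (ct.2 i); have h2 := Zq_lt (ct.1 i).
by move: (nat_of_ord _) (nat_of_ord _) h1 h2 => u v; nia.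
Qed.

Lemma digit_inj ct ct' i : digit ct i = digit ct' i ->
  ct.1 i = ct'.1 i /\ ct.2 i = ct'.2 i.
Proof.
rewrite /digit => e; have q0 : 0 < q by apply: ltnW.
split; apply: val_inj => /=.
  by have := congr1 (modn ^~ q) e; rewrite !modnMDl !modn_small ?Zq_lt.
by have := congr1 (divn ^~ q) e; rewrite !divnMDl // !divn_small ?Zq_lt ?addn0.
Qed.

Lemma code_digits_lt ct s : code_digits ct s < N ^ size s.
Proof.
elim: s => //= i s IH; have := digit_lt ct i; rewrite expnS.
move: IH; move: (code_digits ct s) (digit ct i) (N ^ size s) (q * n) => c d M K.
by nia.
Qed.

Lemma code_digits_cat ct s s' :
  code_digits ct (s ++ s') = code_digits ct s + N ^ size s * code_digits ct s'.
Proof.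
elim: s => [|i s IH] /=; first by rewrite mul1n.
by rewrite IH mulnDr addnA expnS mulnA.
Qed.

Lemma code_digits_inj ct ct' s : code_digits ct s = code_digits ct' s ->
  forall i, i \in s -> digit ct i = digit ct' i.
Proof.
elim: s => //= i s IH e.
have N0 : 0 < N by apply: leq_ltn_trans (digit_lt ct i).
have e1 : digit ct i = digit ct' i.
  have := congr1 (modn ^~ N) e; rewrite /= ![N * _]mulnC ![digit _ _ + _]addnC !modnMDl.
  by rewrite !modn_small ?digit_lt.
have e2 : code_digits ct s = code_digits ct' s.
  by move/eqP: e; rewrite e1 eqn_add2l eqn_pmul2l // => /eqP.
by move=> i'; rewrite in_cons => /orP[/eqP->//|]; exact: IH.
Qed.

(** From the least significant digit on: k/2 positions for the column b, k/2 for the row a, and one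
    for the index i if k is odd. *)
Definition colblock := take k./2 (enum 'I_k).
Definition rowblock := take k./2 (drop k./2 (enum 'I_k)).
Definition idxblock := drop k./2 (drop k./2 (enum 'I_k)).

Lemma half_add : k./2 + (k./2 + odd k) = k.
Proof. by rewrite addnA addnn addnC odd_double_half. Qed.

Lemma size_colblock : size colblock = k./2.
Proof. by rewrite size_takel // size_enum_ord -[leqRHS]half_add leq_addr. Qed.

Lemma size_rowblock : size rowblock = k./2.
Proof. by rewrite size_takel // size_drop size_enum_ord -[X in X - _]half_add addKn leq_addr. Qed.

Lemma size_idxblock : size idxblock = odd k.
Proof. by rewrite !size_drop size_enum_ord -[X in X - _ - _]half_add !addKn. Qed.

Lemma enum_blocks : enum 'I_k = colblock ++ rowblock ++ idxblock.
Proof. by rewrite !cat_take_drop. Qed.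

Lemma col_lt ct : code_digits ct colblock < D.
Proof. by rewrite -size_colblock code_digits_lt. Qed.
Lemma row_lt ct : code_digits ct rowblock < D.
Proof. by rewrite -size_rowblock code_digits_lt. Qed.
Lemma idx_lt ct : code_digits ct idxblock < E.
Proof. by rewrite -size_idxblock code_digits_lt. Qed.

Definition triple_of ct : 'I_E * 'I_D * 'I_D :=
  (Ordinal (idx_lt ct), Ordinal (row_lt ct), Ordinal (col_lt ct)).

Lemma code_triple ct :
  code ct = (triple_of ct).2 + D * ((triple_of ct).1.2 + D * (triple_of ct).1.1).
Proof. by rewrite /code enum_blocks !code_digits_cat size_colblock size_rowblock. Qed.

Lemma code_inj : injective (@code q k n).
Proof.
move=> ct ct' e; have h i : ct.1 i = ct'.1 i /\ ct.2 i = ct'.2 i.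
  by apply: digit_inj; apply: code_digits_inj e _ _; rewrite mem_enum.
case: ct ct' h {e} => [c T] [c' T'] h.
have -> : c = c' by apply/ffunP => i; exact: (h i).1.
by have -> : T = T' by apply/ffunP => i; exact: (h i).2.
Qed.

Lemma triple_of_inj : injective triple_of.
Proof. by move=> ct ct' e; apply: code_inj; rewrite !code_triple e. Qed.

Lemma QE : Q = D * (D * E).
Proof. by rewrite -!expnD half_add. Qed.

Lemma card_constraint : #|constraint q k n| = Q.
Proof. by rewrite card_prod !card_ffun !card_ord Zp_cast // expnMn. Qed.

Lemma triple_of_bij : bijective triple_of.
Proof.
apply: inj_card_bij triple_of_inj _.
rewrite card_constraint QE !card_prod !card_ord.
by rewrite -[leqLHS]mulnA [leqLHS]mulnC -[leqLHS]mulnA.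
Qed.

Lemma occurrences_code I ct : occurrences I (code ct) = count_mem ct I.
Proof. by apply: eq_count => ct' /=; rewrite (inj_eq code_inj). Qed.

Section Target.
Variables (x : Zvec q n) (al : Zvec q k).

Definition agrees s ct := all (fun i => shifted x ct i == al i) s.

(** The event restricted to the positions of [s], as a function of the code of these positions
    alone. The code determines the digits, so any [ct] with this code may serve. *)
Definition block_pred s (K : nat) (v : 'I_K) : bool :=
  [exists ct, (code_digits ct s == v) && agrees s ct].

Lemma block_predE s K (v : 'I_K) ct : code_digits ct s = v -> block_pred s v = agrees s ct.
Proof.
move=> e; apply/existsP/idP => [[ct' /andP[/eqP e' ag]]|ag]; last by exists ct; rewrite e eqxx.
apply/allP => i iS; rewrite -(eqP (allP ag i iS)) /shifted !ffunE.
by case: (digit_inj (code_digits_inj (etrans e (esym e')) iS)) => -> ->.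
Qed.

Lemma shifted_triple ct : (shifted x ct == al) =
  block_pred idxblock (triple_of ct).1.1 && block_pred rowblock (triple_of ct).1.2
   && block_pred colblock (triple_of ct).2.
Proof.
rewrite !(@block_predE _ _ _ ct) //.
have -> : (shifted x ct == al) = agrees (enum 'I_k) ct.
  apply/eqP/allP => [-> //|h]; apply/ffunP => i; apply/eqP; apply: h.
  by rewrite mem_enum.
by rewrite enum_blocks /agrees !all_cat; do 3!case: (all _ _).
Qed.

(** The tuple T is free, and then c = alpha - x_T is forced. *)
Lemma card_shifted : #|[pred ct : constraint q k n | shifted x ct == al]| = n ^ k.
Proof.
have -> : n ^ k = #|{ffun 'I_k -> 'I_n}| by rewrite card_ffun !card_ord.
pose f (T : {ffun 'I_k -> 'I_n}) : constraint q k n :=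
  ([ffun i => (al i - x (T i))%R] : Zvec q k, T).
have f_inj : injective f by move=> T T' [].
rewrite -(finset.card_imset _ f_inj); apply: eq_card => -[c T].
rewrite inE /=; apply/eqP/imsetP => [e|[T' _ [-> ->]]].
  exists T => //; congr (_, _); apply/ffunP => i; rewrite ffunE -e /shifted ffunE /=.
  by rewrite addrC addKr.
by apply/ffunP => i; rewrite /shifted !ffunE /= addrC subrK.
Qed.

Lemma sum_shifted_count I :
  \sum_(ct : constraint q k n) count_mem ct I * (shifted x ct == al)
  = count (fun ct => shifted x ct == al) I.
Proof.
elim: I => [|ct I IH] /=; first by rewrite big1.
rewrite -IH.
under eq_bigr do rewrite mulnDl.
rewrite big_split /= (bigD1 ct) //= eqxx mul1n big1 ?addn0 // => ct' h.
by rewrite eq_sym (negPf h).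
Qed.

(** Reindexing by constraints turns the product of the three block indicators into the event itself;
    the tensor entries sum to Q times its count, less j for each of the n^k constraints in it. *)
Lemma trilinear_shifted (R : realType) j (I : instance q k n) :
  (\sum_i \sum_a \sum_b scaled_tensor R (occurrences I) Q j (i, a, b) *
    (block_pred idxblock (i : 'I_E) && block_pred rowblock (a : 'I_D)
      && block_pred colblock (b : 'I_D))%:R =
  Q%:R * (count (fun ct => shifted x ct == al) I)%:R - j%:R * n%:R ^+ k)%R.
Proof.
pose F (t : 'I_E * 'I_D * 'I_D) : R := (scaled_tensor R (occurrences I) Q j t *
  (block_pred idxblock t.1.1 && block_pred rowblock t.1.2 && block_pred colblock t.2)%:R)%R.
transitivity (\sum_t F t)%R.
  rewrite sum_pair sum_pair; apply: eq_bigr => i _; apply: eq_bigr => a _.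
  by apply: eq_bigr => b _.
rewrite (reindex triple_of) /=; last exact: onW_bij triple_of_bij.
transitivity (\sum_(ct : constraint q k n) (Q%:R * (count_mem ct I * (shifted x ct == al))%:R
   - j%:R * (shifted x ct == al)%:R) : R)%R.
  apply: eq_bigr => ct _; rewrite /F -shifted_triple /scaled_tensor -code_triple occurrences_code.
  by rewrite !natrM mulrBl mulrA.
rewrite sumrB -!mulr_sumr -!natr_sum sum_shifted_count -natrX -card_shifted.
by rewrite -sum1_card [in RHS]big_mkcond.
Qed.

End Target.

Lemma sum_count_shifted x (I : instance q k n) :
  \sum_(al : Zvec q k) count (fun ct => shifted x ct == al) I = size I.
Proof.
elim: I => [|ct I IH] /=; first by rewrite big1.
rewrite big_split /= IH (bigD1 (shifted x ct)) //= eqxx big1 ?addn0 // => al h.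
by rewrite eq_sym (negPf h).
Qed.

Lemma card_Zvec : #|Zvec q k| = q ^ k.
Proof. by rewrite card_ffun !card_ord Zp_cast. Qed.

End Blocks.

(** The tests put each count within j/g of j/q^k. Summing over alpha, m is within q^k j/g <= j/2 of
    j, so j <= 2 m. Each probability is then within 4/g of q^-k, and the distance is at most 2 q^k /
    g <= gamma. *)
Lemma certified_quasirandom (R : realType) q k g n (gamma : R) (I : instance q k n) :
  (2 <= q)%N -> 0 < gamma -> (2 * q ^ k <= g)%N -> 2 * q%:R ^+ k <= gamma * g%:R ->
  certified g I -> quasirandom gamma I.
Proof.
move=> q2 gam0 g1 g2; rewrite /certified /accepts lt0n sum_nat_eq0 negb_forall.
case/existsP => j; rewrite /= !muln_eq0 !eqb0 !negb_or !negbK => /andP[/andP[j0 ft] dt].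
set Q := ((q * n) ^ k)%N in ft dt; set m := size I.
have J0 : (0 : R) < j%:R by rewrite ltr0n.
have Q0 : (0 < Q)%N by apply: leq_trans j0 _; rewrite -ltnS.
have QR : (0 : R) < Q%:R by rewrite ltr0n.
have qk0 : (0 : R) < q%:R ^+ k by rewrite exprn_gt0 // ltr0n ltnW.
have QE' : Q%:R = q%:R ^+ k * n%:R ^+ k :> R by rewrite /Q natrX natrM exprMn.
have gR1 : 2 * q%:R ^+ k <= g%:R :> R by rewrite -natrX -natrM ler_nat.
have gR : (0 : R) < g%:R by apply: lt_le_trans gR1; rewrite mulr_gt0.
have cnt_bound x al : `|(count (fun ct => shifted x ct == al) I)%:R - j%:R / q%:R ^+ k| <= j%:R / g%:R :> R.
  have := tests_trilinear_bound R (block_pred x al (idxblock k) (K := _))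
    (block_pred x al (rowblock k) (K := _)) (block_pred x al (colblock k) (K := _)) (QE q k n) ft dt.
  rewrite trilinear_shifted // -/Q -exprMn.
  set c := (count _ _)%:R => h.
  have h2 : `|g%:R * (Q%:R * c - j%:R * n%:R ^+ k)| <= (Q * j)%:R :> R.
    by rewrite -(@ler_pXn2r _ 2) ?nnegrE // real_normK ?num_real.
  have e : g%:R * (Q%:R * c - j%:R * n%:R ^+ k) = (g%:R * Q%:R) * (c - j%:R / q%:R ^+ k).
    by rewrite QE'; field; rewrite lt0r_neq0.
  move: h2; rewrite e normrM ger0_norm ?mulr_ge0 // natrM => h2.
  by rewrite ler_pdivlMr // -(ler_pM2l QR); move: h2; rewrite [g%:R * _]mulrC -mulrA [g%:R * _]mulrC.
have m_bound : `|m%:R - j%:R| <= q%:R ^+ k * (j%:R / g%:R) :> R.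
  (* The counts add up to m for every assignment; the zero one serves. *)
  pose x : Zvec q n := [ffun=> 0].
  rewrite /m -(sum_count_shifted x I) natr_sum.
  have e : j%:R = \sum_(al : Zvec q k) (j%:R / q%:R ^+ k) :> R.
    by rewrite sumr_const card_Zvec // -[RHS]mulr_natr natrX divfK // lt0r_neq0.
  rewrite [X in _ - X]e -sumrB; apply: le_trans (ler_norm_sum _ _ _) _.
  apply: (@le_trans _ _ (\sum_(al : Zvec q k) j%:R / g%:R)); first exact: ler_sum.
  by rewrite sumr_const card_Zvec // -[leLHS]mulr_natl natrX.
have m_half : j%:R <= 2 * m%:R :> R.
  have h : q%:R ^+ k * (j%:R / g%:R) <= j%:R / 2 :> R.
    rewrite mulrCA; apply: ler_wpM2l => //.
    by rewrite ler_pdivrMr // ler_pdivlMl.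
  have := le_trans m_bound h; rewrite ler_norml => /andP[h1 _]; lra.
have mR : (0 : R) < m%:R by lra.
split; first by rewrite -(ltr0n R).
move=> x; rewrite /tv_dist.
have term (al : Zvec q k) : `|Defs.induced R I x al - uniform_Zvec R al| <= 4 / g%:R.
  rewrite /Defs.induced /uniform_Zvec -/m; set c := (count _ _)%:R.
  have -> : c / m%:R - (q%:R ^+ k)^-1 =
     ((c - j%:R / q%:R ^+ k) + (j%:R - m%:R) / q%:R ^+ k) / m%:R :> R.
    by field; rewrite !lt0r_neq0.
  rewrite normrM normfV (ger0_norm (ltW mR)) ler_pdivrMr //.
  apply: le_trans (ler_normD _ _) _.
  apply: (@le_trans _ _ (j%:R / g%:R + j%:R / g%:R)).
    apply: lerD; first exact: cnt_bound.
    rewrite normrM normfV (ger0_norm (ltW qk0)) ler_pdivrMr // mulrC distrC.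
    exact: m_bound.
  have : j%:R / g%:R <= (2 * m%:R) / g%:R :> R by rewrite ler_wpM2r // invr_ge0 ltW.
  lra.
apply: (@le_trans _ _ (2^-1 * \sum_(al : Zvec q k) 4 / g%:R)).
  by rewrite ler_wpM2l ?invr_ge0 //; exact: ler_sum.
rewrite sumr_const card_Zvec // -[_ *+ (_ ^ _)]mulr_natl natrX.
rewrite (_ : _ * _ = (2 * q%:R ^+ k) / g%:R); last by field; rewrite lt0r_neq0.
by rewrite ler_pdivrMr.
Qed.

(** * Completeness *)

Lemma expectD (R : realType) (C : finType) (p : R) (f g : {set C} -> R) :
  expect p (fun S => f S + g S) = expect p f + expect p g.
Proof. by rewrite /expect -big_split /=; apply: eq_bigr => S _; rewrite mulrDr. Qed.

Lemma occurrences_perm q k n (I J : instance q k n) : perm_eq I J ->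
  occurrences I = occurrences J.
Proof. by move=> /permP IJ; apply/funext => z; exact: IJ. Qed.

Lemma weight_sum_le1 (R : realType) (C : finType) (p : R) (P : pred {set C}) :
  0 <= p <= 1 -> \sum_(S | P S) p ^+ #|S| * (1 - p) ^+ #|~: S| <= 1.
Proof.
move=> p01; rewrite -[leRHS](expect1 C p) /expect [leRHS](bigID P) /=.
under [X in _ <= X + _]eq_bigr do rewrite mulr1.
by rewrite lerDl; apply: sumr_ge0 => S _; rewrite mulr1 weight_ge0.
Qed.

(** Both tests at j, the integer part of p Q, have the form of a scaled nonnegative statistic being
    at most 1. Markov's inequality is applied once, to the sum of the two statistics. *)
Lemma prob_certified_ge (R : realType) q k g n (p : R) :
  let Q := ((q * n) ^ k)%N in
  let D := ((q * n) ^ k./2)%N in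
  let l := (2 ^ trunc_log 2 (trunc_log 2 n))%N in
  let L := p * Num.sqrt Q%:R in
  (2 <= q)%N -> (2 <= k)%N -> (0 < n)%N -> 0 <= p <= 1 -> 2 <= L ->
  1 - ((8 * g%:R ^+ 2 / L) ^+ (2 * l) * D%:R ^+ 2 * (2 * l + 2)%:R ^+ (6 * l + 2)
       + 8 * g%:R ^+ 2 / L)
  <= @prob_random_csp R q k n p (certifies (certifier q k g)).
Proof.
move=> Q D l L q2 k2 n0 p01 L2; case/andP: (p01) => p0 p1.
set E := ((q * n) ^ odd k)%N; set s := trunc_log 2 (trunc_log 2 n).
have N0 : (0 < q * n)%N by rewrite muln_gt0 n0 andbT ltnW.
have Q0 : (0 < Q)%N by rewrite expn_gt0 N0.
have E0 : (0 < E)%N by rewrite expn_gt0 N0.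
have D0 : (0 < D)%N by rewrite expn_gt0 N0.
have QDE : Q = (D * (D * E))%N := QE q k n.
have QR : (0 : R) < Q%:R by rewrite ltr0n.
have ER : (0 : R) < E%:R by rewrite ltr0n.
have DR : (0 : R) < D%:R by rewrite ltr0n.
set X := Num.sqrt Q%:R : R in L L2 *.
have X0 : 0 < X by rewrite sqrtr_gt0.
have X2 : X ^+ 2 = Q%:R by rewrite sqr_sqrtr // ltW.
have X1 : 1 <= X by rewrite -[leLHS]sqrtr1 ler_sqrt // ler1n.
have L0 : 0 < L by apply: lt_le_trans L2.
have L1 : 1 <= L by apply: le_trans L2; rewrite ler1n.
have XDE : X = D%:R * Num.sqrt E%:R.
  rewrite /X QDE mulnA natrM natrM -expr2 sqrtrM ?sqr_ge0 //.
  by rewrite sqrtr_sqr ger0_norm // ltW.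
have EX : E%:R <= X.
  have ED : (E * E <= Q)%N.
    (* Here k >= 2 enters: E has exponent at most 1, and D at least 1. *)
    have h : (E <= D)%N by rewrite leq_pexp2l //; case: (k) k2 => [|[|[|k']]] //=; case: (odd _).
    by rewrite QDE mulnA leq_mul // (leq_trans h) // leq_pmulr.
  rewrite -(@ler_pXn2r _ 2) ?nnegrE ?(ltW ER) ?(ltW X0) // X2 expr2 -natrM ler_nat.
  exact: ED.
have pQ : p * Q%:R = L * X by rewrite -X2 expr2 mulrA.
have pQ2 : 2 <= p * Q%:R by rewrite pQ; nra.
pose j := Num.truncn (p * Q%:R).
have pQ0 : 0 <= p * Q%:R by rewrite mulr_ge0 // ltW.
have jle : j%:R <= p * Q%:R by rewrite truncn_le.
have jgt : p * Q%:R < j%:R + 1 by rewrite natr1 truncnS_gt.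
(* From j > p Q - 1 and p Q >= 2. *)
have jhalf : p * Q%:R <= 2 * j%:R by lra.
have j0 : (0 < j)%N by rewrite truncn_gt0 (le_trans _ pQ2) // ler1n.
have JR : (0 : R) < j%:R by rewrite ltr0n.
have jQ : (j <= Q)%N.
  by rewrite -(ler_nat R) (le_trans jle) // ler_piMl // ltW.
pose rho : R := j%:R / Q%:R.
have rho0 : 0 <= rho by rewrite divr_ge0.
have rhop : rho <= p by rewrite ler_pdivrMr.
(* Rounding p Q down to j changes p by less than 1/Q, which is at most 1/X. *)
have rhox : p - rho <= X^-1.
  rewrite lerBlDr; apply: (@le_trans _ _ (Q%:R^-1 + rho)).
    rewrite -(ler_pM2r QR) mulrDl mulVf ?lt0r_neq0 // divfK ?lt0r_neq0 //.
    by rewrite addrC ltW.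
  rewrite lerD2r lef_pV2 ?posrE //.
  by rewrite -X2 expr2 ler_peMr // ltW.
(* Chosen so that lam^2 / X is exactly p. *)
pose lam := Num.sqrt L.
have lam2 : lam ^+ 2 = L by rewrite sqr_sqrtr // ltW.
have lam1 : 1 <= lam by rewrite -[leLHS]sqrtr1 /lam ler_wsqrtr.
have px : p = L * X^-1 by rewrite /L mulfK // lt0r_neq0.
have px' : p <= lam ^+ 2 * X^-1 by rewrite lam2 -px.
pose e0 : R := (Num.sqrt E%:R)^-1.
have sE0 : 0 < Num.sqrt (E%:R : R) by rewrite sqrtr_gt0.
have e00 : 0 <= e0 by rewrite invr_ge0 ltW.
have e0E : e0 ^+ 2 = #|'I_E|%:R^-1 by rewrite card_ord exprVn sqr_sqrtr // ltW.
have e01 : e0 <= 1 by rewrite invf_le1 // -[leLHS]sqrtr1 ler_sqrt // ler1n.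
have D0' : (0 < #|'I_D|)%N by rewrite card_ord.
have x0E : X^-1 = #|'I_D|%:R^-1 * e0 by rewrite card_ord XDE invfM.
case: (triple_of_bij k n q2) => phi phiK phiK'.
have phi_inj : injective phi by exact: can_inj phiK'.
have tensorE (S : {set constraint q k n}) t :
  scaled_tensor R (occurrences (enum S)) Q j t = Q%:R * centered phi rho S t.
  rewrite /scaled_tensor /centered -{1 2 3}(phiK' t) -code_triple occurrences_code //.
  rewrite count_uniq_mem ?enum_uniq // mem_enum natrM mulrBr /rho.
  by rewrite [Q%:R * (_ / _)]mulrC divfK // lt0r_neq0.
pose c : R := (2 * g * g * Q)%:R * Q%:R ^+ 2.
have pairE (S : {set constraint q k n}) :
  scaled_pairmx R (occurrences (enum S)) g E Q j =
  (fun x y : 'I_D * 'I_D => c * pairmx (centered phi rho S) x y).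
  apply/funext => x; apply/funext => y; rewrite /scaled_pairmx /c -mulrA -pairmxZ.
  by congr (_ * pairmx _ x y); apply/funext => t; exact: tensorE.
pose Phi S := \sum_x gram_pow (centered phi rho S) l x x.
pose F2 S := \sum_(i : 'I_E) \sum_(a : 'I_D) \sum_(b : 'I_D) centered phi rho S (i, a, b) ^+ 2.
have Qj0 : (0 : R) < (Q * j)%:R by rewrite ltr0n muln_gt0 Q0.
pose al : R := c ^+ (2 * l) / (Q * j)%:R ^+ (4 * l).
pose be : R := (2 * g * g * E)%:R * Q%:R ^+ 2 / (Q * j)%:R ^+ 2.
have al0 : 0 <= al by rewrite divr_ge0 ?exprn_ge0 ?(ltW Qj0) // mulr_ge0 ?exprn_ge0 ?ler0n.
have be0 : 0 <= be by rewrite divr_ge0 ?exprn_ge0 ?(ltW Qj0) // mulr_ge0 ?exprn_ge0 ?ler0n.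
have frobE (S : {set constraint q k n}) : frobenius_test (occurrences (enum S)) g E D Q j s = (al * Phi S <= 1).
  rewrite (frobenius_testE R) pairE frobenius2_gram_iterZ frobenius2_trace -/l.
  by rewrite /al mulrAC ler_pdivrMr ?exprn_gt0 // mul1r.
have diagE (S : {set constraint q k n}) : diagonal_test (occurrences (enum S)) g E Q j = (be * F2 S <= 1).
  rewrite (diagonal_testE R _ _ _ QDE) /be mulrAC ler_pdivrMr ?exprn_gt0 // mul1r.
  rewrite -mulrA; congr (_ * _ <= _); rewrite /F2 mulr_sumr; apply: eq_bigr => i _.
  rewrite mulr_sumr; apply: eq_bigr => a _; rewrite mulr_sumr; apply: eq_bigr => b _.
  by rewrite tensorE exprMn.
have Phi0 S : 0 <= Phi S.
  rewrite /Phi /l -frobenius2_trace; apply: sumr_ge0 => x _; apply: sumr_ge0 => y _.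
  exact: sqr_ge0.
have F20 S : 0 <= F2 S.
  by apply: sumr_ge0 => i _; apply: sumr_ge0 => a _; apply: sumr_ge0 => b _; exact: sqr_ge0.
have Phi_le : expect p Phi <= L ^+ (2 * l) * D%:R ^+ 2 * (2 * l + 2)%:R ^+ (6 * l + 2).
  have := expect_trace phi_inj p01 rho0 rhop rhox lam1 px' e00 e0E e01 D0' x0E l.
  by rewrite card_ord (_ : (4 * l = 2 * (2 * l))%N) ?exprM ?lam2 // mulnA.
have F2_le : expect p F2 <= Q%:R * p.
  rewrite /F2 expect_sum.
  under eq_bigr do rewrite expect_sum.
  under eq_bigr do under eq_bigr do rewrite expect_sum.
  apply: (@le_trans _ _ (\sum_(i < E) \sum_(a < D) \sum_(b < D) p)); last first.
    by rewrite !sumr_const !card_ord -!mulrnA -[leLHS]mulr_natl QDE [(D * E)%N]mulnC mulnA.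
  apply: ler_sum => i _; apply: ler_sum => a _; apply: ler_sum => b _.
  apply: le_trans (ler_norm _) _.
  (* A square is a product of two factors on one element: the bound is lam^2 / X = p. *)
  have := expect_centered_prod p01 rho0 rhop rhox lam1 px' [:: phi (i, a, b); phi (i, a, b)].
  rewrite (@eq_expect _ _ _ _ (fun S => centered phi rho S (i, a, b) ^+ 2)); last first.
    by move=> S; rewrite !big_cons big_nil mulr1 expr2.
  rewrite /= (_ : [set z in [:: phi (i, a, b); phi (i, a, b)]] = [set phi (i, a, b)]).
    by rewrite cards1 lam2 expr1 -px.
  by apply/setP => z; rewrite !inE orbb.
pose f S := al * Phi S + be * F2 S.
have fle : expect p f <= (8 * g%:R ^+ 2 / L) ^+ (2 * l) * D%:R ^+ 2 * (2 * l + 2)%:R ^+ (6 * l + 2)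
       + 8 * g%:R ^+ 2 / L.
  rewrite /f expectD !expectZ; apply: lerD.
    apply: le_trans (ler_wpM2l al0 Phi_le) _.
    rewrite (mulrA al) (mulrA al); apply: ler_wpM2r; first by rewrite exprn_ge0.
    apply: ler_wpM2r; first by rewrite exprn_ge0.
    rewrite /al (_ : (4 * l = 2 * (2 * l))%N) ?[(Q * j)%:R ^+ _]exprM; last by rewrite mulnA.
    rewrite -expr_div_n -exprMn; apply: lerXn2r.
    - by rewrite nnegrE mulr_ge0 ?(ltW L0) // divr_ge0 ?exprn_ge0 ?(ltW Qj0) // mulr_ge0 ?exprn_ge0 ?ler0n.
    - by rewrite nnegrE divr_ge0 ?(ltW L0) ?mulr_ge0 ?exprn_ge0.
    have -> : c / (Q * j)%:R ^+ 2 * L = (2 * g%:R ^+ 2 * L * Q%:R) / j%:R ^+ 2.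
      by rewrite /c !natrM; field; rewrite !lt0r_neq0.
    rewrite ler_pdivrMr ?exprn_gt0 // [leRHS]mulrAC ler_pdivlMr //.
    (* As p Q = L X is at most 2 j, the base 2 g^2 L Q / j^2 is at most 8 g^2 / L. *)
    have : (L * X) ^+ 2 <= (2 * j%:R) ^+ 2.
      by rewrite -pQ lerXn2r ?nnegrE // mulr_ge0 // ltW.
    rewrite (exprMn 2 L X) (exprMn 2 2) X2 => h.
    rewrite [leLHS](_ : _ = 2 * g%:R ^+ 2 * (L ^+ 2 * Q%:R)); last by ring.
    rewrite [leRHS](_ : _ = 2 * g%:R ^+ 2 * (2 ^+ 2 * j%:R ^+ 2)); last by ring.
    by apply: ler_wpM2l; [rewrite mulr_ge0 | exact: h].
  apply: le_trans (ler_wpM2l be0 F2_le) _.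
  have -> : be * (Q%:R * p) = (2 * g%:R ^+ 2 * E%:R * (p * Q%:R)) / j%:R ^+ 2.
    by rewrite /be !natrM; field; rewrite !lt0r_neq0.
  rewrite ler_pdivrMr ?exprn_gt0 // [leRHS]mulrAC ler_pdivlMr //.
  have h1 : (L * X) ^+ 2 <= (2 * j%:R) ^+ 2.
    by rewrite -pQ lerXn2r ?nnegrE // mulr_ge0 // ltW.
  have h2 : (E%:R * (p * Q%:R)) * L <= (L * X) ^+ 2.
    rewrite pQ expr2 mulrAC [L * X * (L * X)]mulrA.
    rewrite (_ : E%:R * L * (L * X) = (L * L * X) * E%:R); last by ring.
    rewrite (_ : L * X * L * X = (L * L * X) * X); last by ring.
    by rewrite ler_wpM2l // !mulr_ge0 // ltW.
  rewrite [leLHS](_ : _ = 2 * g%:R ^+ 2 * ((E%:R * (p * Q%:R)) * L)); last by ring.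
  rewrite [leRHS](_ : _ = 2 * g%:R ^+ 2 * ((2 * j%:R) ^+ 2)); last by ring.
  by rewrite ler_wpM2l ?mulr_ge0 ?exprn_ge0 // (le_trans h2).
apply: le_trans (_ : _ <= 1 - expect p f / 1) _; first by rewrite divr1 lerB.
rewrite /prob_random_csp; apply: markov_expect => //.
  by move=> S; rewrite addr_ge0 // mulr_ge0.
move=> S; rewrite leNgt; apply: contra => fS.
have h1 : al * Phi S <= 1.
  by apply: le_trans (ltW fS); rewrite lerDl mulr_ge0.
have h2 : be * F2 S <= 1.
  by apply: le_trans (ltW fS); rewrite lerDr mulr_ge0.
apply/asboolP => I IS; apply/certifier_certifies.
rewrite /certified /accepts (occurrences_perm IS) lt0n sum_nat_eq0 negb_forall.
apply/existsP; exists (Ordinal (jQ : (j < Q.+1)%N)).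
by rewrite /= frobE diagE h1 h2 j0.
Qed.

(** * Asymptotics of the failure probability *)

(** From exp(-1/2) >= 1 - 1/2. *)
Lemma ln2_ge_half (R : realType) : 2^-1 <= ln (2 : R).
Proof.
rewrite -[leLHS]expRK ler_ln ?posrE ?expR_gt0 //.
have h := @expR_ge1Dx R (- 2^-1).
rewrite -[leLHS]invrK -expRN invf_ple ?posrE ?expR_gt0 //.
by apply: le_trans h; lra.
Qed.

Lemma trunc_log_le_ln (R : realType) n : (0 < n)%N ->
  (trunc_log 2 n)%:R / 2 <= ln n%:R :> R.
Proof.
move=> n0; have h : (2 ^ trunc_log 2 n <= n)%N by exact: trunc_logP.
apply: (@le_trans _ _ (ln ((2 ^ trunc_log 2 n)%:R))); last first.
  by rewrite ler_ln ?posrE ?ltr0n ?expn_gt0 // ler_nat.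
by rewrite natrX lnXn // -[leRHS]mulr_natl ler_wpM2l // ln2_ge_half.
Qed.

(** With t the integer part of log_2 n, L is at least of order t^5, so r = (2 l + 2)^3 8 g^2 / L is
    of order t^-2 and eventually below 2^-(k+3). As n <= 2^(2 l), r^(2 l) is at most n^-(k+3). This
    beats D^2 (2 l + 2)^2 <= 16 q^k n^(k+2) and leaves 16 q^k / n. *)
Lemma error_small (R : realType) (q k g : nat) (gamma eps : R) : (0 < q)%N -> 0 < gamma -> 0 < eps ->
  exists t0 : nat, forall (n : nat) (L : R), (t0 <= trunc_log 2 n)%N ->
    ln n%:R ^+ 5 / gamma ^+ 2 <= L ->
    let l := (2 ^ trunc_log 2 (trunc_log 2 n))%N in
    2 <= L /\
    (8 * g%:R ^+ 2 / L) ^+ (2 * l) * ((q * n) ^ k./2)%:R ^+ 2 * (2 * l + 2)%:R ^+ (6 * l + 2)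
       + 8 * g%:R ^+ 2 / L <= eps.
Proof.
move=> q0 gam0 eps0; set G : R := g%:R ^+ 2; set a : R := gamma ^+ 2.
have a0 : 0 < a by rewrite exprn_gt0.
have G0 : 0 <= G by rewrite exprn_ge0.
have qk0 : (0 : R) < q%:R ^+ k by rewrite exprn_gt0 // ltr0n.
(* The four summands serve in turn for L >= 2, for the second error term, for the remainder 16 q^k /
   n, and for r <= 2^-(k+3). *)
pose B := 64 * a + 16 * 32 * G * a / eps + 32 * q%:R ^+ k / eps + 128 * 128 * G * a * 2 ^+ (k + 3).
have b1 : 0 <= 64 * a := mulr_ge0 (ler0n _ _) (ltW a0).
have b2 : 0 <= 16 * 32 * G * a / eps.
  exact: divr_ge0 (mulr_ge0 (mulr_ge0 (mulr_ge0 (ler0n _ _) (ler0n _ _)) G0) (ltW a0)) (ltW eps0).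
have b3 : 0 <= 32 * q%:R ^+ k / eps.
  exact: divr_ge0 (mulr_ge0 (ler0n _ _) (ltW qk0)) (ltW eps0).
have b4 : 0 <= 128 * 128 * G * a * 2 ^+ (k + 3).
  exact: mulr_ge0 (mulr_ge0 (mulr_ge0 (mulr_ge0 (ler0n _ _) (ler0n _ _)) G0) (ltW a0)) (exprn_ge0 _ (ler0n _ _)).
exists (Num.truncn B).+1 => n L; set t := trunc_log 2 n => tB hL l.
have tR1 : B <= t%:R.
  by apply: (@le_trans _ _ (Num.truncn B).+1%:R); [exact: ltW (truncnS_gt _) | rewrite ler_nat].
have c1 : 64 * a <= t%:R by rewrite /B in tR1; lra.
have c2 : 16 * 32 * G * a <= t%:R * eps by rewrite -ler_pdivrMr //; rewrite /B in tR1; lra.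
have c3 : 32 * q%:R ^+ k <= t%:R * eps by rewrite -ler_pdivrMr //; rewrite /B in tR1; lra.
have c4 : 128 * 128 * G * a * 2 ^+ (k + 3) <= t%:R by rewrite /B in tR1; lra.
have t0 : (0 < t)%N by apply: leq_trans tB.
have tR : (1 : R) <= t%:R by rewrite ler1n.
have n0 : (0 < n)%N by rewrite lt0n; apply: contraL t0 => /eqP n0; rewrite /t n0 trunc_log0.
have tn : (t <= n)%N by exact: trunc_log_le.
have tp : (0 : R) < t%:R by apply: lt_le_trans tR.
have hL2 : t%:R ^+ 5 / (32 * a) <= L.
  apply: le_trans hL.
  rewrite (_ : t%:R ^+ 5 / (32 * a) = (t%:R / 2) ^+ 5 / a); last by field; rewrite lt0r_neq0.
  rewrite ler_wpM2r ?invr_ge0 ?(ltW a0) // lerXn2r ?nnegrE ?divr_ge0 ?trunc_log_le_ln //.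
  by apply: le_trans (trunc_log_le_ln R n0); rewrite divr_ge0.
have t51 : t%:R <= t%:R ^+ 5 :> R by rewrite -[leLHS]expr1 ler_weXn2l.
have L2 : 2 <= L.
  apply: le_trans hL2; rewrite ler_pdivlMr ?mulr_gt0 //.
  by apply: le_trans t51; lra.
have L0 : 0 < L by apply: lt_le_trans L2.
have invL : L^-1 <= (32 * a) / t%:R ^+ 5.
  rewrite -[leRHS]invrK lef_pV2 ?posrE ?invr_gt0 ?divr_gt0 ?exprn_gt0 ?mulr_gt0 //.
  by rewrite invf_div.
split=> //.
have e2 : 8 * G / L <= eps / 2.
  apply: (@le_trans _ _ (8 * G * (32 * a / t%:R ^+ 5))).
    by rewrite ler_wpM2l // mulr_ge0.
  rewrite mulrA ler_pdivrMr ?exprn_gt0 //.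
  apply: (@le_trans _ _ (eps / 2 * t%:R)); first by lra.
  by rewrite ler_wpM2l // divr_ge0 // ltW.
(* The power l of 2 satisfies l <= t < 2 l: small enough for (2 l + 2)^3 to be dominated by L, large
   enough for n <= 2^(2 l). *)
have lt_ : (l <= t)%N by exact: trunc_logP.
have tl : (t < 2 * l)%N by rewrite -expnS; exact: trunc_log_ltn.
have n2l : (n <= 2 ^ (2 * l))%N.
  apply: ltnW; apply: leq_trans (trunc_log_ltn _ (isT : (1 < 2)%N)) _.
  by rewrite leq_exp2l.
pose r := (2 * l + 2)%:R ^+ 3 * (8 * G / L).
have r0 : 0 <= r by rewrite mulr_ge0 ?exprn_ge0 // divr_ge0 ?(ltW L0) // mulr_ge0.
have l4 : (2 * l + 2 <= 4 * t)%N by move: (l) (t) lt_ t0; clear; lia.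
have rle : r <= (2 ^+ (k + 3))^-1.
  have h1 : (2 * l + 2)%:R ^+ 3 <= (4 * t%:R) ^+ 3 :> R.
    by rewrite lerXn2r ?nnegrE ?mulr_ge0 // -natrM ler_nat.
  apply: (@le_trans _ _ ((4 * t%:R) ^+ 3 * (8 * G * (32 * a / t%:R ^+ 5)))).
    apply: ler_pM; rewrite ?exprn_ge0 ?divr_ge0 ?mulr_ge0 ?(ltW L0) //.
    by rewrite ler_wpM2l // mulr_ge0.
  rewrite (_ : _ * _ = 128 * 128 * G * a / t%:R ^+ 2); last by field; rewrite lt0r_neq0.
  rewrite ler_pdivrMr ?exprn_gt0 // [leRHS]mulrC ler_pdivlMr ?exprn_gt0 //.
  by apply: le_trans c4 _; rewrite expr2 ler_peMr // ltW.
have nR : (0 : R) < n%:R by rewrite ltr0n.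
have rl : r ^+ (2 * l) <= (n%:R ^+ (k + 3))^-1.
  apply: (@le_trans _ _ (((2 ^+ (k + 3))^-1) ^+ (2 * l))).
    by rewrite lerXn2r ?nnegrE ?invr_ge0 ?exprn_ge0.
  rewrite exprVn lef_pV2 ?posrE ?exprn_gt0 // -exprM mulnC exprM.
  by rewrite lerXn2r ?nnegrE ?exprn_ge0 ?(ltW nR) // -natrX ler_nat.
have Dle : ((q * n) ^ k./2)%:R ^+ 2 <= q%:R ^+ k * n%:R ^+ k :> R.
  rewrite -natrX -!natrX -natrM ler_nat -expnMn -expnM leq_pexp2l ?muln_gt0 ?q0 //.
  by rewrite muln2 -[leqRHS]odd_double_half leq_addl.
have e1 : (8 * G / L) ^+ (2 * l) * ((q * n) ^ k./2)%:R ^+ 2 * (2 * l + 2)%:R ^+ (6 * l + 2) <= eps / 2.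
  have -> : (8 * G / L) ^+ (2 * l) * ((q * n) ^ k./2)%:R ^+ 2 * (2 * l + 2)%:R ^+ (6 * l + 2) =
     r ^+ (2 * l) * ((q * n) ^ k./2)%:R ^+ 2 * (2 * l + 2)%:R ^+ 2.
    have e6 : (6 * l + 2 = 3 * (2 * l) + 2)%N by rewrite mulnA.
    rewrite e6 exprD (exprM _ 3 (2 * l)) /r (exprMn (2 * l) ((2 * l + 2)%:R ^+ 3)).
    move: ((8 * G / L) ^+ (2 * l)) (((2 * l + 2)%:R ^+ 3) ^+ (2 * l)) => u v.
    move: (((q * n) ^ k./2)%:R ^+ 2) ((2 * l + 2)%:R ^+ 2) => w z.
    by ring.
  apply: (@le_trans _ _ ((n%:R ^+ (k + 3))^-1 * (q%:R ^+ k * n%:R ^+ k) * (4 * n%:R) ^+ 2)).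
    apply: ler_pM; rewrite ?mulr_ge0 ?exprn_ge0 //.
      by apply: ler_pM; rewrite ?exprn_ge0.
    rewrite lerXn2r ?nnegrE ?mulr_ge0 // -natrM ler_nat.
    by apply: leq_trans l4 _; rewrite leq_mul2l tn orbT.
  have -> : (n%:R ^+ (k + 3))^-1 * (q%:R ^+ k * n%:R ^+ k) * (4 * n%:R) ^+ 2 = 16 * q%:R ^+ k / n%:R :> R.
    rewrite exprD; field; rewrite expf_neq0 ?lt0r_neq0 //.
  rewrite ler_pdivrMr //; apply: (@le_trans _ _ (eps / 2 * t%:R)); first by lra.
  by rewrite ler_wpM2l ?ler_nat // divr_ge0 // ltW.
by lra.
Qed.

(** * The algorithm and its guarantees *)

Local Open Scope classical_set_scope.
Local Open Scope ring_scope.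

Theorem theoremB6 (R : realType) :
  exists C : nat,
  forall (q k : nat) (P : Zvec q k -> bool) (gamma : R),
    (2 <= q)%N -> (2 <= k)%N -> 0 < gamma ->
  exists A : cmd,
    [/\ poly_time q k A,
        sound_for_quasirandom q k gamma A
      & forall p : nat -> R,
          (forall n, 0 <= p n <= 1) ->
          (\forall n \near \oo,
             q%:R ^+ (C * k) * n%:R `^ (k%:R / 2) * ln (n%:R) ^+ 5 / gamma ^+ 2
               <= q%:R ^+ k * n%:R ^+ k * p n) ->
          (fun n => @prob_random_csp R q k n (p n) (certifies A)) @ \oo --> (1 : R)].
Proof.
(* C = 1 is enough, because sqrt Q = (q n)^(k/2) is at most q^k n^(k/2). *)
exists 1%N => q k _ gamma q2 k2 gam0.
have qk0 : (0 : R) < q%:R ^+ k by rewrite exprn_gt0 // ltr0n ltnW.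
(* The first summand gives j <= 2 m in the soundness proof, the second makes 2 q^k / g at most
   gamma. *)
pose g := (2 * q ^ k + (Num.truncn (2 * q%:R ^+ k / gamma)).+1)%N.
have g1 : (2 * q ^ k <= g)%N by exact: leq_addr.
have g2 : 2 * q%:R ^+ k <= gamma * g%:R.

  rewrite -ler_pdivrMl // mulrC.
  apply: le_trans (ltW (truncnS_gt _)) _.
  by rewrite ler_nat leq_addl.
exists (certifier q k g); split.
- exact: certifier_poly_time.
- move=> n I /certifier_certifies; exact: certified_quasirandom.
move=> p p01 hp; apply/cvgrPdist_le => eps eps0.
have [t0 ht] := error_small k g (ltnW q2) gam0 eps0.
near=> n.
have n0 : (0 < n)%N by near: n; exact: nbhs_infty_gt.
have tn : (t0 <= trunc_log 2 n)%N.
  have : (2 ^ t0 <= n)%N by near: n; exact: nbhs_infty_ge.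
  exact: trunc_log_max.
have hn : q%:R ^+ (1 * k) * n%:R `^ (k%:R / 2) * ln (n%:R) ^+ 5 / gamma ^+ 2
   <= q%:R ^+ k * n%:R ^+ k * p n by near: n.
set Q := ((q * n) ^ k)%N.
have QE' : Q%:R = q%:R ^+ k * n%:R ^+ k :> R by rewrite /Q natrX natrM exprMn.
have nR : (0 : R) < n%:R by rewrite ltr0n.
have Q0 : (0 : R) < Q%:R by rewrite QE' mulr_gt0 // exprn_gt0.
have X0 : 0 < Num.sqrt (Q%:R : R) by rewrite sqrtr_gt0.
have Xle : Num.sqrt Q%:R <= q%:R ^+ k * n%:R `^ (k%:R / 2) :> R.
  rewrite -(@ler_pXn2r _ 2) ?nnegrE ?(ltW X0) ?mulr_ge0 ?(ltW qk0) ?powR_ge0 //.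
  have e : (n%:R `^ (k%:R / 2)) ^+ 2 = n%:R ^+ k :> R.
    by rewrite -powR_mulrn ?powR_ge0 // -powRrM divfK // powR_mulrn // ltW.
  rewrite sqr_sqrtr ?(ltW Q0) // exprMn e QE' ler_wpM2r ?exprn_ge0 ?(ltW nR) //.
  by rewrite expr2 ler_peMr ?(ltW qk0) // exprn_ege1 // ler1n ltnW.
(* The expected number of constraints is p Q; dividing the density hypothesis by sqrt Q gives the
   lower bound on L. *)
have hL : ln n%:R ^+ 5 / gamma ^+ 2 <= p n * Num.sqrt Q%:R.
  rewrite -(ler_pM2r X0) -[leRHS]mulrA -expr2 sqr_sqrtr ?(ltW Q0) //.
  rewrite [leLHS]mulrC [leRHS]mulrC [in leRHS]QE'.
  apply: le_trans hn; rewrite mul1n [leLHS]mulrA ler_wpM2r ?invr_ge0 ?sqr_ge0 // ler_wpM2r //.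
  by rewrite exprn_ge0 // ln_ge0 // ler1n.
have [L2 err] := ht n _ tn hL.
have := prob_certified_ge g q2 k2 n0 (p01 n) L2.
(* A probability is at most 1, so its distance to 1 is the failure probability. *)
have := @weight_sum_le1 R _ (p n) (fun S => `[< forall I : instance q k n, perm_eq I (enum S) -> certifies (certifier q k g) I >]) (p01 n).
rewrite -/(prob_random_csp (p n) (certifies (certifier q k g))) => h1 h2.
rewrite ger0_norm ?subr_ge0 //; lra.
Unshelve. all: by end_near.
Qed.
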